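(* Let $f\in C^{\infty}(\mathbb{R}^n)$ be a real-valued function. For every $g\in C^\infty(\mathbb{R}^n)$ and every open set $S\subset\mathbb{R}$, $$B(f)\subset K_{\infty}^{(g,S)}(f)\cup K_0(f).$$ Therefore $$B(f)\subset \bigcap_{(g,S)\in\Xi} K_{\infty}^{(g,S)}(f)\ \cup\ K_0(f),$$ where $\Xi=\{(g,S) : g\in C^{\infty}(\mathbb{R}^n),\ S \text{ open in } \mathbb{R}\}$.
   Context: Norms and inner products are Euclidean; functions are real-valued. $B(f)$, the set of bifurcation values of $f$, is the smallest set $B\subset\mathbb{R}$ such that $f$ is a (locally trivial) $C^\infty$ fibration over $\mathbb{R}\setminus B$; that is, $\lambda\notin B(f)$ if and only if there are a neighborhood $U$ of $\lambda$ and a $C^\infty$ diffeomorphism $f^{-1}(U)\to f^{-1}(\lambda)\times U$ whose second component is $f$ (the fibre may be empty). $K_0(f)$ is the set of critical values of $f$, i.e. of those $\lambda$ for which $\nabla f(x)=0$ for some $x\in f^{-1}(\lambda)$. At points $x$ where $\nabla g(x)\neq 0$, put $$\nabla_g f(x):=\nabla f(x)-\frac{\langle\nabla f(x),\nabla g(x)\rangle}{\|\nabla g(x)\|^{2}}\nabla g(x).$$ For an open set $U\subset\mathbb{R}$ and $R>0$ put $D_{(U,R)}:=f^{-1}(U)\setminus\{x\in\mathbb{R}^n : \|x\|\le R\}$. The function $f$ satisfies the $(g,S)$-Malgrange condition over $U$ if there exists $R>0$ such that: (1) $\nabla g(x)\neq 0$ for all $x\in D_{(U,R)}$; (2) $D_{(U,R)}\subset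 g^{-1}(S)$; (3) for every $s\in S$ there exists $\delta_s>0$ such that $\|\nabla_g f(x)\|\,\|x\|\ge\delta_s$ for all $x\in D_{(U,R)}\cap g^{-1}(s)$. The function $f$ satisfies the $(g,S)$-Malgrange condition in $\lambda\in\mathbb{R}$ if there is an (open) neighborhood $U$ of $\lambda$ such that $f$ satisfies it over $U$. $K_{\infty}^{(g,S)}(f)$ denotes the set of all $\lambda\in\mathbb{R}$ in which $f$ does not satisfy the $(g,S)$-Malgrange condition. *)

(* Defs.v *)
From HB Require Import structures.
From mathcomp Require Import all_boot all_order all_algebra.
From mathcomp Require Import all_classical all_reals all_analysis.
Import Order.TTheory GRing.Theory Num.Theory.
Import numFieldNormedType.Exports.

Set Implicit Arguments.
Unset Strict Implicit.
Unset Printing Implicit Defensive.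

Local Open Scope classical_set_scope.
Local Open Scope ring_scope.

Section Smooth.
Context {R : realType}.

(* [Ck_on k O F]: F is of class C^k on the open set O.  Differentiability is
   Frechet differentiability, and the derivative is recorded through all its
   directional derivatives; for finite-dimensional V (the only use made of it
   below) this is the usual notion of a C^k map. *)
Fixpoint Ck_on {V W : normedModType R} (k : nat) (O : set V) (F : V -> W) :
    Prop :=
  match k with
  | 0 => forall x, O x -> {for x, continuous F}
  | k'.+1 => (forall x, O x -> differentiable F x) /\
             (forall v, Ck_on k' O ('D_v F))
  end.

Definition smooth {V W : normedModType R} (F : V -> W) : Prop :=
  forall k, Ck_on k [set: V] F.

(* Smoothness on an arbitrary subset A: F locally extends to a C^oo map defined
   on an open set of the ambient space.  On open sets, on embedded submanifolds
   and on products of these it is the intrinsic notion. *)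
Definition smooth_on {V W : normedModType R} (A : set V) (F : V -> W) : Prop :=
  forall x, A x -> exists (O : set V) (F' : V -> W),
    [/\ open_nbhs x O, forall k, Ck_on k O F' &
        forall y, A y -> O y -> F' y = F y].

Definition diffeomorphism {V W : normedModType R} (A : set V) (B : set W)
    (Phi : V -> W) : Prop :=
  [/\ set_bij A B Phi, smooth_on A Phi &
      exists2 Psi : W -> V, smooth_on B Psi &
        forall x, A x -> Psi (Phi x) = x].

End Smooth.

Section Bifurcation.
Context {R : realType} {n : nat}.
Implicit Types (f g : 'rV[R]_n -> R) (S U : set R) (x u v : 'rV[R]_n).

Definition dot u v : R := \sum_i u 0 i * v 0 i.

(* The library norm [`|x|] on row vectors is the sup norm, hence this one. *)
Definition enorm u : R := Num.sqrt (dot u u).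

Definition grad f x : 'rV[R]_n := \row_i 'D_(delta_mx 0 i) f x.

Definition trivial_over f (lambda : R) U : Prop :=
  exists2 Phi : 'rV[R]_n -> 'rV[R]_n * R,
    diffeomorphism (f @^-1` U) ((f @^-1` [set lambda]) `*` U) Phi &
    forall x, U (f x) -> (Phi x).2 = f x.

(* When lambda is a critical value the fibre need not be a submanifold, and
   [diffeomorphism] is then meant in the ambient sense of [smooth_on]; such a
   lambda is always a bifurcation value, since applying the chain rule to
   f (Psi (y, t)) = t shows that a diffeomorphism as above excludes critical
   points in the fibre. *)
Definition bifurcation_values f : set R :=
  [set lambda | ~ exists2 U, open_nbhs lambda U & trivial_over f lambda U].

Definition critical_values f : set R :=
  [set lambda | exists2 x, f x = lambda & grad f x = 0].

Definition rel_grad g f x : 'rV[R]_n :=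
  grad f x - (dot (grad f x) (grad g x) / enorm (grad g x) ^+ 2) *: grad g x.

Definition outer_tube f U (r : R) : set 'rV[R]_n :=
  (f @^-1` U) `\` [set x | enorm x <= r].

Definition malgrange_over g S f U : Prop :=
  exists2 r : R, 0 < r &
    [/\ forall x, outer_tube f U r x -> grad g x != 0,
        outer_tube f U r `<=` g @^-1` S &
        forall s, S s -> exists2 delta : R, 0 < delta &
          forall x, (outer_tube f U r `&` g @^-1` [set s]) x ->
            delta <= enorm (rel_grad g f x) * enorm x].

Definition malgrange_at g S f (lambda : R) : Prop :=
  exists2 U, open_nbhs lambda U & malgrange_over g S f U.

Definition malgrange_bad_values g S f : set R :=
  [set lambda | ~ malgrange_at g S f lambda].

Definition smooth_open_pairs : set (('rV[R]_n -> R) * set R) :=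
  [set gS | smooth gS.1 /\ open gS.2].

End Bifurcation.

(* Main.v *)
(* Outside a large ball the field grad_g f / |grad_g f|^2 raises f at unit speed and preserves g;
   on a fixed level g = s the Malgrange condition bounds its norm by |x| / delta_s, so its
   integral curves cannot escape to infinity in finite time.  Inside the ball grad f / |grad f|^2
   does the same job, since by compactness f has no critical point there at levels close to
   lambda.  Gluing both with smooth cutoffs of |x|^2 and of f - lambda gives a smooth complete
   vector field w with <w, grad f> = 1 near the fibre over lambda.  If E (x, s) denotes the point
   reached from x after time s along w, then x |-> (E (x, lambda - f x), f x) trivializes f over a
   neighbourhood of lambda, with inverse (y, t) |-> E (y, t - lambda). *)
Require Import Defs.
From HB Require Import structures.
From mathcomp Require Import all_boot all_order all_algebra.
From mathcomp Require Import all_classical all_reals all_analysis.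
From mathcomp Require Import ring lra.
Import Order.TTheory GRing.Theory Num.Theory.
Import numFieldNormedType.Exports.
Set Implicit Arguments.
Unset Strict Implicit.
Unset Printing Implicit Defensive.
Local Open Scope classical_set_scope.
Local Open Scope ring_scope.

(** * Calculus of C^k maps *)

(** The obstacle is that delta_s need not be bounded below as s varies. The growth of the glued
    field w is controlled on each level of g separately, while a trajectory may change its level
    whenever it passes through the ball, possibly again and again. So there is no global growth
    estimate, and completeness takes the separate argument of [flow_complete]. The two gradient
    fields are glued before being normalized. Both have nonnegative product with grad f, so weights
    that are nonnegative and never vanish together are enough; a single division by the total rate
    of growth of f replaces a partition of unity. E (x, s) is the time-one point along s w, so
    negative times and smoothness in time reduce to time-one maps of autonomous fields. Existence is
    first proved up to time 2 for fields clamped to a box, which are globally Lipschitz; the reserve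
    beyond 1 lets a line be continued past any time tau < 1. *)

Section CkBasics.
Context {R : realType}.
Implicit Types (V W X : normedModType R).

Lemma Ck_sub V W k (O O' : set V) (F : V -> W) :
  O' `<=` O -> Ck_on k O F -> Ck_on k O' F.
Proof.
move=> OO'; elim: k F => [|k IH] F /=; first by move=> h x /OO'; exact: h.
by move=> [dF h]; split=> [x /OO'|v]; [exact: dF|exact/IH].
Qed.

(** Derivatives are taken in the whole space, so [Ck_on] is a family of conditions at single points
    and can be checked point by point. *)
Lemma Ck_local V W k (O : set V) (F : V -> W) :
  (forall x, O x -> exists2 O', O' x & Ck_on k O' F) -> Ck_on k O F.
Proof.
elim: k F => [|k IH] F /= Fl.
  by move=> x /Fl [U Ux]; apply.
split=> [x /Fl [U Ux [dF _]]|v]; first exact: dF.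
by apply: IH => x /Fl [U Ux [_ dF]]; exists U.
Qed.

Lemma Ck_pred V W k (O : set V) (F : V -> W) : Ck_on k.+1 O F -> Ck_on k O F.
Proof.
elim: k F => [|k IH] F; last by move=> [dF h]; split=> // v; exact/IH.
by move=> [dF _] x Ox; exact/differentiable_continuous/dF.
Qed.

Lemma Ck_continuous V W k (O : set V) (F : V -> W) x :
  Ck_on k O F -> O x -> {for x, continuous F}.
Proof. by elim: k => [|k IH]; [exact|move/Ck_pred]. Qed.

(** The form of differentiability used where a derivative comes from an estimate: [expinv] at 0 and
    the time-one map in [flow_Ck]. *)
Lemma differentiable_eps V W (F : V -> W) (L : {linear V -> W}) x :
  continuous L ->
  (forall e, 0 < e ->
    \forall h \near (0 : V), `|F (h + x) - F x - L h| <= e * `|h|) ->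
  differentiable F x /\ 'd F x = L :> (V -> W).
Proof.
move=> cL H.
have E : F \o shift x = cst (F x) + L +o_ (0 : V) id.
  apply/eqaddoP => e e0; apply: filterS (H e e0) => h.
  by rewrite !fctE /= opprD addrA.
have dL := diff_unique cL E.
by split => //; apply/diff_locallyP; rewrite dL.
Qed.

Lemma near_eq_differentiable V W (F G : V -> W) x :
  {near x, F =1 G} -> differentiable F x -> differentiable G x.
Proof.
move=> FG dF; have cF := diff_continuous dF.
apply: (proj1 (@differentiable_eps _ _ G ('d F x) x cF _)) => e e0.
have := diff_locally dF; move=> /eqaddoP /(_ e e0) H.
have FG0 : \forall h \near (0 : V), F (h + x) = G (h + x).
  by move: FG; rewrite (near_shift 0) /=; apply: filterS => h /=; rewrite subr0.
apply: filterS2 FG0 H => h FGh.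
by rewrite !fctE /= opprD addrA FGh (nbhs_singleton FG).
Qed.

Lemma open_near_eq V W (O : set V) (F G : V -> W) x : open O ->
  (forall x, O x -> F x = G x) -> O x -> {near x, F =1 G}.
Proof.
by move=> oO FG Ox; apply: filterS (open_nbhs_nbhs (conj oO Ox)) => y /FG ->.
Qed.

(** Equality on an open set is equality near each of its points, so it passes to derivatives. The
    inductions below use this to replace the derivative of a compound map by its explicit
    formula. *)
Lemma Ck_eq V W k (O : set V) (F G : V -> W) : open O ->
  (forall x, O x -> F x = G x) -> Ck_on k O F -> Ck_on k O G.
Proof.
move=> oO; elim: k F G => [|k IH] F G FG.
  move=> cF x Ox; have /near_eq_cvg GF := open_near_eq oO FG Ox.
  have : G y @[y --> x] --> F x by apply: cvg_trans (cF x Ox); exact: GF.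
  by rewrite FG.
move=> [dF h]; split=> [x Ox|v]; last first.
  by apply: IH (h v) => x Ox; apply: near_eq_derive; exact: open_near_eq Ox.
exact: near_eq_differentiable (open_near_eq oO FG Ox) (dF x Ox).
Qed.

Lemma Ck_cst V W k (O : set V) (w : W) : Ck_on k O (cst w).
Proof.
elim: k w => [|k IH] w; first by move=> x _; exact: cvg_cst.
split=> [x _|v]; first exact: differentiable_cst.
have -> : 'D_v (cst w) = cst 0 :> (V -> W) by apply/funext => x; rewrite derive_cst.
exact: IH.
Qed.

Lemma derive_lin V W (L : {linear V -> W}) x v : continuous L -> 'D_v L x = L v.
Proof.
by move=> cL; rewrite deriveE ?diff_lin //; exact: linear_differentiable.
Qed.

Lemma Ck_lin V W k (O : set V) (L : {linear V -> W}) :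
  continuous L -> Ck_on k O L.
Proof.
move=> cL; case: k => [|k]; first by move=> x _; exact: cL.
split=> [x _|v]; first exact: linear_differentiable.
have -> : 'D_v L = cst (L v) by apply/funext => x; rewrite derive_lin.
exact: Ck_cst.
Qed.

Lemma Ck_lin_comp V W X k (O : set V) (F : V -> W) (L : {linear W -> X}) :
  open O -> continuous L -> Ck_on k O F -> Ck_on k O (L \o F).
Proof.
move=> oO cL; elim: k F => [|k IH] F.
  by move=> cF x Ox; apply: continuous_comp; [exact: cF|exact: cL].
move=> [dF h]; have dL y : differentiable L y by exact: linear_differentiable.
split=> [x Ox|v]; first by apply: differentiable_comp (dL _); exact: dF.
apply: (Ck_eq oO) (IH _ (h v)) => x Ox.
have dFx := dF x Ox.
have dLF : differentiable (L \o F) x by exact: differentiable_comp.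
by rewrite (deriveE _ dLF) (diff_comp dFx (dL _)) /= (diff_lin _ cL) (deriveE _ dFx).
Qed.

Lemma Ck_add V W k (O : set V) (F G : V -> W) : open O ->
  Ck_on k O F -> Ck_on k O G -> Ck_on k O (fun x => F x + G x).
Proof.
move=> oO; elim: k F G => [|k IH] F G.
  by move=> cF cG x Ox; apply: cvgD; [exact: cF|exact: cG].
move=> [dF hF] [dG hG].
split=> [x Ox|v]; first by apply: differentiableD; [exact: dF|exact: dG].
apply: (Ck_eq oO) (IH _ _ (hF v) (hG v)) => x Ox.
by rewrite deriveD //; apply: diff_derivable; [exact: dF|exact: dG].
Qed.

Lemma Ck_sum V W k (O : set V) I (r : seq I) (F : I -> V -> W) : open O ->
  (forall i, Ck_on k O (F i)) -> Ck_on k O (fun x => \sum_(i <- r) F i x).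
Proof.
move=> oO h; elim: r => [|i r IH].
  rewrite (_ : (fun _ => _) = cst 0); first exact: Ck_cst.
  by apply/funext => x; rewrite big_nil.
rewrite (_ : (fun _ => _) = (fun x => F i x + \sum_(j <- r) F j x)).
  exact: Ck_add.
by apply/funext => x; rewrite big_cons.
Qed.

Lemma Ck_mul V k (O : set V) (F G : V -> R) : open O ->
  Ck_on k O F -> Ck_on k O G -> Ck_on k O (fun x => F x * G x).
Proof.
move=> oO; elim: k F G => [|k IH] F G.
  by move=> cF cG x Ox; apply: cvgM; [exact: cF|exact: cG].
move=> /[dup] /Ck_pred cF [dF hF] /[dup] /Ck_pred cG [dG hG].
split=> [x Ox|v]; first by apply: differentiableM; [exact: dF|exact: dG].
have := Ck_add oO (IH _ _ cF (hG v)) (IH _ _ cG (hF v)).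
apply: (Ck_eq oO) => x Ox.
by rewrite deriveM //; apply: diff_derivable; [exact: dF|exact: dG].
Qed.

Lemma Ck_inv V k (O : set V) (F : V -> R) : open O ->
  (forall x, O x -> F x != 0) -> Ck_on k O F -> Ck_on k O (fun x => (F x)^-1).
Proof.
move=> oO F0; elim: k => [|k IH].
  by move=> cF x Ox; apply: cvgV; [exact: F0|exact: cF].
move=> /[dup] /Ck_pred cF [dF hF].
split=> [x Ox|v]; first by apply: differentiableV; [exact: dF|exact: F0].
have := Ck_mul oO (@Ck_cst V R k O (-1 : R)) (Ck_mul oO (Ck_mul oO (IH cF) (IH cF)) (hF v)).
apply: (Ck_eq oO) => x Ox.
rewrite deriveV ?F0 //; last by apply: diff_derivable; exact: dF.
by rewrite /= mulN1r scaleNr expr2 invfM.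
Qed.

End CkBasics.

(* Coordinates on a finite-dimensional normed space.  Unlike a fixed 'rV[R]_m, this class is
   closed under binary products, so that tangent bundles V * V stay inside it. *)
Record frame (R : realType) (V : normedModType R) := Frame {
  fidx : finType;
  fvec : fidx -> V;
  fco : fidx -> {linear V -> R};
  fco_continuous : forall i, continuous (fco i);
  fco_vec : forall i j, fco i (fvec j) = (i == j)%:R;
  frame_sum : forall x, x = \sum_i fco i x *: fvec i;
  box_compact : forall r : R, compact [set x | forall i, `|fco i x| <= r] }.

Arguments fidx {R V}.
Arguments fvec {R V}.
Arguments fco {R V}.
Arguments fco_continuous {R V}.
Arguments fco_vec {R V}.
Arguments frame_sum {R V}.
Arguments box_compact {R V}.

(** * Coordinates, chain rule and products *)

Section Frames.
Context {R : realType}.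
Implicit Types (V W X : normedModType R).

Lemma frame_eq V (B : frame V) (x y : V) :
  (forall i, fco B i x = fco B i y) -> x = y.
Proof.
by move=> xy; rewrite [x](frame_sum B) [y](frame_sum B); apply: eq_bigr => i _; rewrite xy.
Qed.

Lemma scalel_linear V (w : V) : linear ( *:%R ^~ w : R -> V).
Proof. by move=> u y z; rewrite scalerDl scalerA. Qed.

Definition scalel V (w : V) : {linear R -> V} :=
  HB.pack ( *:%R ^~ w : R -> V) (GRing.isLinear.Build _ _ _ _ _ (scalel_linear w)).

Lemma scalel_cont V (w : V) : continuous (scalel w).
Proof. exact: scalel_continuous. Qed.

Lemma Ck_coord V W (B : frame W) k (O : set V) (F : V -> W) : open O ->
  (forall i, Ck_on k O (fco B i \o F)) -> Ck_on k O F.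
Proof.
move=> oO cF.
have : Ck_on k O (fun x => \sum_i fco B i (F x) *: fvec B i).
  apply: Ck_sum => // i.
  exact: Ck_lin_comp oO (@scalel_cont W (fvec B i)) (cF i).
by apply: Ck_eq => // x _; rewrite -frame_sum.
Qed.

Lemma derive_frame V W (B : frame V) (F : V -> W) x v : differentiable F x ->
  'D_v F x = \sum_i fco B i v *: 'D_(fvec B i) F x.
Proof.
move=> dF; rewrite deriveE // {1}[v](frame_sum B) linear_sum.
by apply: eq_bigr => i _; rewrite linearZ deriveE.
Qed.

(** For real G the chain rule gives a finite sum of products of real functions, to which [Ck_mul]
    and the induction hypothesis apply. *)
Lemma Ck_comp_real V W (B : frame W) k (O : set V) (U : set W) (F : V -> W) (G : W -> R) :
  open O -> (forall x, O x -> U (F x)) ->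
  Ck_on k O F -> Ck_on k U G -> Ck_on k O (G \o F).
Proof.
move=> oO OU; elim: k G => [|k IH] G.
  by move=> cF cG x Ox; apply: continuous_comp; [exact: cF|by apply: cG; apply: OU].
move=> /[dup] /Ck_pred cF [dF hF] [dG hG].
have dGF x : O x -> differentiable (G \o F) x.
  by move=> Ox; apply: differentiable_comp; [exact: dF|by apply: dG; apply: OU].
split=> // v.
have : Ck_on k O (fun x => \sum_i fco B i ('D_v F x) * ('D_(fvec B i) G \o F) x).
  apply: Ck_sum => // i; apply: Ck_mul => //; last exact: (IH _ cF (hG _)).
  exact: Ck_lin_comp oO (fco_continuous B i) (hF v).
apply: Ck_eq => // x Ox.
rewrite (deriveE _ (dGF x Ox)) (diff_comp (dF x Ox) (dG _ (OU _ Ox))) /=.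
rewrite -(deriveE _ (dF x Ox)) -(deriveE _ (dG _ (OU _ Ox))).
by rewrite (derive_frame B _ (dG _ (OU _ Ox))).
Qed.

Lemma Ck_comp V W X (B : frame W) (C : frame X) k (O : set V) (U : set W)
    (F : V -> W) (G : W -> X) :
  open O -> open U -> (forall x, O x -> U (F x)) ->
  Ck_on k O F -> Ck_on k U G -> Ck_on k O (G \o F).
Proof.
move=> oO oU OU cF cG; apply: (Ck_coord (B := C) oO) => i.
apply: (@Ck_comp_real _ _ B k O U F (fco C i \o G) oO OU cF).
exact: Ck_lin_comp oU (fco_continuous C i) cG.
Qed.

Lemma derive_pair V W X (F : V -> W) (G : V -> X) x v :
  differentiable F x -> differentiable G x ->
  'D_v (fun y => (F y, G y)) x = ('D_v F x, 'D_v G x).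
Proof.
move=> dF dG; rewrite deriveE; last exact: differentiable_pair.
by rewrite diff_pair // (deriveE _ dF) (deriveE _ dG).
Qed.

Lemma Ck_pair V W X k (O : set V) (F : V -> W) (G : V -> X) : open O ->
  Ck_on k O F -> Ck_on k O G -> Ck_on k O (fun x => (F x, G x)).
Proof.
move=> oO; elim: k F G => [|k IH] F G.
  by move=> cF cG x Ox; apply: cvg_pair; [exact: cF|exact: cG].
move=> [dF hF] [dG hG].
split=> [x Ox|v]; first by apply: differentiable_pair; [exact: dF|exact: dG].
apply: (Ck_eq oO) (IH _ _ (hF v) (hG v)) => x Ox.
by rewrite derive_pair //; [exact: dF|exact: dG].
Qed.

Definition lfst V W : {linear (V * W)%type -> V} := [the {linear (V * W)%type -> V} of fst].
Definition lsnd V W : {linear (V * W)%type -> W} := [the {linear (V * W)%type -> W} of snd].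

Lemma lfst_cont V W : continuous (lfst V W).
Proof. by move=> x; exact: cvg_fst. Qed.

Lemma lsnd_cont V W : continuous (lsnd V W).
Proof. by move=> x; exact: cvg_snd. Qed.

Lemma Ck_fst V W k (O : set (V * W)) : Ck_on k O (fst : V * W -> V).
Proof. exact: (Ck_lin k O (@lfst_cont V W)). Qed.

Lemma Ck_snd V W k (O : set (V * W)) : Ck_on k O (snd : V * W -> W).
Proof. exact: (Ck_lin k O (@lsnd_cont V W)). Qed.

Section ProdFrame.
Context (V W : normedModType R) (B : frame V) (C : frame W).

Definition prod_vec (i : fidx B + fidx C) : V * W :=
  match i with inl i => (fvec B i, 0) | inr j => (0, fvec C j) end.

Definition prod_co (i : fidx B + fidx C) : {linear (V * W)%type -> R} :=
  match i with
  | inl i => [the {linear (V * W)%type -> R} of fco B i \o lfst V W]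
  | inr j => [the {linear (V * W)%type -> R} of fco C j \o lsnd V W]
  end.

Lemma prod_co_continuous i : continuous (prod_co i).
Proof.
case: i => i x.
  by apply: continuous_comp; [exact: lfst_cont|exact: fco_continuous].
by apply: continuous_comp; [exact: lsnd_cont|exact: fco_continuous].
Qed.

Lemma prod_co_vec i j : prod_co i (prod_vec j) = (i == j)%:R.
Proof. by case: i j => i [] j /=; rewrite ?fco_vec ?linear0. Qed.

Lemma prod_frame_sum x : x = \sum_i prod_co i x *: prod_vec i.
Proof.
rewrite big_sumType /=; case: x => x y /=.
have pE (I : finType) (c : I -> R) (v : I -> V) (w : I -> W) :
    \sum_i c i *: (v i, w i) = (\sum_i c i *: v i, \sum_i c i *: w i).
  by elim/big_rec3 : _ => // i a b _ _ ->.
rewrite !pE {1}(frame_sum B x) {1}(frame_sum C y).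
congr pair => /=.
  by rewrite [X in _ + X]big1 ?addr0 // => i _; rewrite scaler0.
by rewrite [X in X + _]big1 ?add0r // => i _; rewrite scaler0.
Qed.

Lemma prod_box_compact (r : R) : compact [set x | forall i, `|prod_co i x| <= r].
Proof.
have := compact_setX (box_compact B r) (box_compact C r).
congr compact; apply/seteqP; split=> -[x y] /=.
  by move=> [hx hy] [i|i] /=.
by move=> h; split=> i; [exact: (h (inl i))|exact: (h (inr i))].
Qed.

Definition prod_frame : frame (V * W)%type :=
  Frame prod_co_continuous prod_co_vec prod_frame_sum prod_box_compact.

End ProdFrame.

Definition real_co (i : 'I_1) : {linear R -> R} := [the {linear R -> R} of idfun].

Definition real_frame : frame R.
Proof.
refine (@Frame R R 'I_1 (fun _ => 1) real_co _ _ _ _).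
- by move=> i x; exact: cvg_id.
- by move=> i j; rewrite !ord1 eqxx.
- by move=> x; rewrite big_ord1 /= /GRing.scale /= mulr1.
- move=> r; rewrite (_ : mkset _ = `[- r, r]%classic); first exact: segment_compact.
  apply/seteqP; split=> x /=; first by move=> /(_ ord0); rewrite in_itv /= ler_norml.
  by rewrite in_itv /= -ler_norml.
Defined.

Lemma row_co_linear n (i : 'I_n) : linear (fun x : 'rV[R]_n => x 0 i : R).
Proof. by move=> a x y; rewrite !mxE. Qed.

Definition row_co n (i : 'I_n) : {linear 'rV[R]_n -> R} :=
  HB.pack (fun x : 'rV[R]_n => x 0 i : R) (GRing.isLinear.Build _ _ _ _ _ (row_co_linear i)).

Definition row_frame n : frame 'rV[R]_n.
Proof.
refine (@Frame R 'rV[R]_n 'I_n (delta_mx 0) (@row_co n) _ _ _ _).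
- by move=> i x; exact: (@coord_continuous R 1 n 0 i x).
- by move=> i j; rewrite /row_co /= mxE eqxx.
- by move=> x; rewrite [LHS]row_sum_delta.
- move=> r.
  have := @rV_compact R n (fun _ => `[- r, r]%classic) (fun=> @segment_compact _ _ _).
  congr compact; apply/seteqP; split=> x /= h i.
    by have := h i; rewrite /= in_itv /= -ler_norml.
  by rewrite in_itv /= -ler_norml; exact: h.
Defined.

(** [Ck_on] only speaks of fixed directions. Joint regularity in point and direction follows by
    expanding the direction over the frame, since the derivative is linear in it. *)
Lemma Ck_tangent V W (B : frame V) (C : frame W) k (F : V -> W) : smooth F ->
  Ck_on k [set: V * V] (fun p => 'D_p.2 F p.1).
Proof.
move=> sF.
have : Ck_on k [set: V * V] (fun p => \sum_i fco B i p.2 *: ('D_(fvec B i) F \o fst) p).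
  apply: Ck_sum => [|i]; first exact: openT.
  apply: (Ck_coord (B := C)) => [|j]; first exact: openT.
  have -> : fco C j \o (fun p : V * V => fco B i p.2 *: ('D_(fvec B i) F \o fst) p) =
      (fun p => fco B i p.2 * ((fco C j \o 'D_(fvec B i) F) \o fst) p).
    by apply/funext => p /=; rewrite linearZ.
  apply: Ck_mul; first exact: openT.
    apply: (Ck_lin_comp openT (fco_continuous B i)); exact: Ck_snd.
  apply: (Ck_comp_real B openT (U := setT)) => //; first exact: Ck_fst.
  apply: (Ck_lin_comp openT (fco_continuous C j)).
  by have [_] := sF k.+1; apply.
apply: Ck_eq; first exact: openT.
move=> p _ /=; rewrite -derive_frame //.
by have [dF _] := sF 1; exact: dF.
Qed.

End Frames.

(** * Differential inequalities and flow lines *)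

Section RealCurves.
Context {R : realType}.
Implicit Types (y z : R -> R).

Lemma is_derive_curve (V W : normedModType R) (c : R -> V) (F : V -> W) (t : R) d :
  is_derive t 1 c d -> differentiable F (c t) ->
  is_derive t 1 (F \o c) ('D_d F (c t)).
Proof.
move=> [dc <-] dF; have dct : differentiable c t by exact/derivable1_diffP.
have dFc : differentiable (F \o c) t by exact: differentiable_comp.
apply: DeriveDef; first exact: diff_derivable.
by rewrite (deriveE _ dFc) diff_comp //= -(deriveE _ dct) -(deriveE _ dF).
Qed.

Lemma is_derive_real_comp (f g : R -> R) (t df dg : R) :
  is_derive t 1 g dg -> is_derive (g t) 1 f df ->
  is_derive t 1 (f \o g) (dg * df).
Proof.
move=> hg [hf <-]; have dfg : differentiable f (g t) by exact/derivable1_diffP.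
apply: is_derive_eq; first exact: (is_derive_curve hg dfg).
by rewrite !deriveE // -[X in 'd _ _ X]mulr1 -[_ * _]/(dg *: 1) linearZ.
Qed.

Lemma is_derive_exp (x : R) : is_derive x 1 expR (expR x).
Proof.
apply: DeriveDef; first exact: derivable_expR.
exact: (congr1 (fun f => f x) (@derive_expR R)).
Qed.

Lemma within_cont (T : topologicalType) (c : R -> T) (A : set R) :
  continuous c -> {within A, continuous c}.
Proof. exact: continuous_subspaceT. Qed.

(** The mean value theorem for y - z; derivatives are only required in the open interval. *)
Lemma increment_le y z dy dz (a b : R) : a <= b ->
  {within `[a, b], continuous y} -> {within `[a, b], continuous z} ->
  (forall t, a < t < b -> is_derive t 1 y (dy t)) ->
  (forall t, a < t < b -> is_derive t 1 z (dz t)) ->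
  (forall t, a < t < b -> dy t <= dz t) ->
  y b - y a <= z b - z a.
Proof.
move=> ab cy cz hy hz yz.
have [<-|ltab] := eqVneq a b; first by rewrite !subrr.
have {}ltab : a < b by rewrite lt_neqAle ltab.
have [||d] := @MVT R (y \- z) (dy \- dz) a b ltab.
- by move=> t; rewrite in_itv /= => t_ab; apply: is_deriveB; [exact: hy|exact: hz].
- by move=> s; apply: continuousB; [exact: cy|exact: cz].
rewrite in_itv /= => /yz dyz /= E; move: E.
have : (dy d - dz d) * (b - a) <= 0.
  by apply: mulr_le0_ge0; rewrite ?subr_ge0 ?subr_le0 // ltW.
lra.
Qed.

Lemma increment_bound y dy (a b M : R) : a <= b ->
  {within `[a, b], continuous y} ->
  (forall t, a < t < b -> is_derive t 1 y (dy t)) ->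
  (forall t, a < t < b -> `|dy t| <= M) ->
  `|y b - y a| <= M * (b - a).
Proof.
move=> ab cy hy My.
have hM t : a < t < b -> is_derive t 1 (fun s => M * s) M.
  by move=> _; apply: is_derive_eq; rewrite /GRing.scale /= mulr1.
have cM : {within `[a, b], continuous (fun s : R => M * s)}.
  by apply: within_cont => s; exact: mulrl_continuous.
have h1 := @increment_le y _ dy _ a b ab cy cM hy hM.
have cNy : {within `[a, b], continuous (fun s : R => - y s)}.
  by move=> s; apply: continuousN; exact: cy.
have hNy t : a < t < b -> is_derive t 1 (fun s : R => - y s) (- dy t).
  by move=> tab; apply: is_deriveN; exact: hy.
have h2 := @increment_le _ _ _ _ a b ab cNy cM hNy hM.
rewrite ler_norml; apply/andP; split.
  have /h2 : forall t, a < t < b -> - dy t <= M.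
    by move=> t /My; rewrite ler_norml; lra.
  lra.
have /h1 : forall t, a < t < b -> dy t <= M.
  by move=> t /My; rewrite ler_norml; lra.
lra.
Qed.

Lemma gronwall y dy (a b A B : R) : 0 <= A -> 0 <= B -> a <= b ->
  {within `[a, b], continuous y} ->
  (forall t, a < t < b -> is_derive t 1 y (dy t)) ->
  (forall t, a < t < b -> dy t <= A * y t + B) ->
  y b <= expR (A * (b - a)) * (y a + B * (b - a)).
Proof.
move=> A0 B0 ab cy hy Hy.
(* Integrating factor: the derivative of e y is at most B e, hence at most B, because e <= 1 on
   [a, b]. *)
pose e (t : R) := expR (- (A * (t - a))).
have he (t : R) : is_derive t 1 e (- A * e t).
  have ha : is_derive t 1 (fun s : R => - (A * (s - a))) (- A).
    by apply: is_derive_eq; rewrite subr0 /GRing.scale /= mulr1.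
  exact: is_derive_real_comp ha (is_derive_exp _).
have ce : continuous e.
  move=> s; apply: differentiable_continuous; apply/derivable1_diffP.
  by have [] := he s.
have /(_ _ _ _ _ _) h := @increment_le (fun t => e t * y t) (fun t => B * t)
  (fun t => e t * dy t + y t * (- A * e t)) (fun=> B) a b ab.
have {}h : e b * y b - e a * y a <= B * b - B * a.
  apply: h => [||t tab|t tab|t tab].
  - by move=> s; apply: continuousM; [exact: within_cont|exact: cy].
  - by apply: within_cont => s; exact: mulrl_continuous.
  - exact: is_deriveM (he t) (hy t tab).
  - by apply: is_derive_eq; rewrite /GRing.scale /= mulr1.
  - have e1 : e t <= 1.
      by rewrite /e expR_le1 oppr_le0 mulr_ge0 // subr_ge0; lra.
    have e0 : 0 < e t by exact: expR_gt0.
    have := Hy t tab; nra.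
have ea : e a = 1 by rewrite /e subrr mulr0 oppr0 expR0.
rewrite -(ler_pM2l (expR_gt0 (- (A * (b - a))))) mulrA -expRD addNr expR0 -/(e b).
move: h; rewrite ea; lra.
Qed.
End RealCurves.

(** * Coordinate norm, Lipschitz bounds and clamping to a box *)

Section FrameNorm.
Context {R : realType} {V : normedModType R} (B : frame V).
Implicit Types (x y : V) (i : fidx B).

Definition fnorm x : R := \sum_i `|fco B i x|.

Lemma fnorm_ge0 x : 0 <= fnorm x.
Proof. by apply: sumr_ge0. Qed.

Lemma le_fnorm i x : `|fco B i x| <= fnorm x.
Proof. by rewrite /fnorm (bigD1 i) //= lerDl; exact: sumr_ge0. Qed.

Lemma fnorm_le (M : R) x : (forall i, `|fco B i x| <= M) -> fnorm x <= #|fidx B|%:R * M.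
Proof.
move=> h; apply: (@le_trans _ _ (\sum_(i : fidx B) M)); first exact: ler_sum.
by rewrite sumr_const mulr_natl.
Qed.

Lemma fnorm_le0 x : fnorm x <= 0 -> x = 0.
Proof.
move=> h; apply: (frame_eq (B := B)) => i; apply/eqP.
by rewrite linear0 -normr_le0 (le_trans (le_fnorm i x)).
Qed.

Lemma fnorm0 : fnorm 0 = 0.
Proof. by rewrite /fnorm big1 // => i _; rewrite linear0 normr0. Qed.

Lemma fnormN x : fnorm (- x) = fnorm x.
Proof. by apply: eq_bigr => i _; rewrite linearN normrN. Qed.

Lemma fnormD x y : fnorm (x + y) <= fnorm x + fnorm y.
Proof.
by rewrite /fnorm -big_split; apply: ler_sum => i _; rewrite linearD ler_normD.
Qed.

Lemma fnormB x y : fnorm (x - y) = fnorm (y - x).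
Proof. by rewrite -fnormN opprB. Qed.

Lemma fnorm_dist x y z : fnorm (x - z) <= fnorm (x - y) + fnorm (y - z).
Proof. by apply: le_trans (fnormD _ _); rewrite addrA subrK. Qed.

Lemma fnorm_le_norm : exists2 K, 0 < K & forall x, fnorm x <= K * `|x|.
Proof.
have h i := linear_lipschitz (fco_continuous B i).
exists (1 + \sum_i (s2val (cid2 (h i)))).
  by rewrite ltr_pwDl // sumr_ge0 // => i _; case: (cid2 (h i)) => k /= k0 _; exact: ltW.
move=> x; rewrite mulrDl mul1r mulr_suml ler_wpDl //.
by apply: ler_sum => i _; case: (cid2 (h i)) => k /= _; exact.
Qed.

Lemma norm_le_fnorm : exists2 K, 0 < K & forall x, `|x| <= K * fnorm x.
Proof.
exists (1 + \sum_i `|fvec B i|) => [|x]; first by rewrite ltr_pwDl // sumr_ge0.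
rewrite {1}[x](frame_sum B); apply: le_trans (ler_norm_sum _ _ _) _.
rewrite mulrDl mul1r mulr_suml ler_wpDl ?fnorm_ge0 //.
by apply: ler_sum => i _; rewrite normrZ mulrC ler_wpM2l // le_fnorm.
Qed.

Definition box (r : R) : set V := [set x | forall i, `|fco B i x| <= r].

Lemma box_segment r x y (t : R) : box r x -> box r y -> 0 <= t <= 1 ->
  box r (y + t *: (x - y)).
Proof.
move=> bx by_ /andP[t0 t1] i; rewrite linearD linearZ linearB /=.
have := bx i; have := by_ i; rewrite !ler_norml => /andP[? ?] /andP[? ?].
by rewrite /GRing.scale /=; apply/andP; split; nra.
Qed.

Lemma bounded_on_compact (K : set V) (G : V -> R) : compact K ->
  (forall x, {for x, continuous G}) -> exists2 M, 0 <= M & forall x, K x -> `|G x| <= M.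
Proof.
move=> cK cG.
have : compact (G @` K) by apply: continuous_compact => //; exact: continuous_subspaceT.
move/compact_bounded => [M [_ hM]]; exists (`|M| + 1) => [|x Kx]; first exact: addr_ge0.
by apply: (hM (`|M| + 1)); [rewrite ltr_pwDr // ler_norm|exists x].
Qed.

Lemma mean_value (G : V -> R) x y : (forall z, differentiable G z) ->
  exists2 t : R, 0 <= t <= 1 & G x - G y = 'D_(x - y) G (y + t *: (x - y)).
Proof.
move=> dG; pose c (t : R) := y + t *: (x - y).
have hc (t : R) : is_derive t 1 c (x - y).
  have -> : c = cst y + ( *:%R^~ (x - y) : R -> V) by apply/funext.
  have dl : is_derive t 1 ( *:%R^~ (x - y) : R -> V) (x - y).
    apply: DeriveDef; first by apply: diff_derivable.
    by rewrite deriveE // diff_val scale1r.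
  by apply: is_derive_eq; rewrite add0r.
have hG (t : R) := is_derive_curve (hc t) (dG (c t)).
have [|t] := @MVT_segment R (G \o c) (fun t => 'D_(x - y) G (c t)) 0 1 ler01.
- apply: within_cont => t; apply/differentiable_continuous/derivable1_diffP.
  by have [] := hG t.
have c1 : c 1 = x by rewrite /c scale1r addrC subrK.
have c0 : c 0 = y by rewrite /c scale0r addr0.
rewrite in_itv /= c1 c0 subr0 mulr1 => t01 E.
by exists t.
Qed.

Lemma box_lipschitz_real r (G : V -> R) : Ck_on 1 setT G ->
  exists2 L, 0 <= L & forall x y, box r x -> box r y -> `|G x - G y| <= L * fnorm (x - y).
Proof.
move=> [dG cG].
have h i := bounded_on_compact (box_compact B r) (fun x => cG (fvec B i) x I).
exists (\sum_i s2val (cid2 (h i))).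
  by apply: sumr_ge0 => i _; case: cid2.
move=> x y bx by_; have [t t01 ->] := mean_value x y (fun z => dG z I).
set z := y + _; have bz : box r z by exact: box_segment.
rewrite (derive_frame B _ (dG z I)) mulr_suml.
apply: le_trans (ler_norm_sum _ _ _) _; apply: ler_sum => i _.
case: cid2 => M /= M0 hM; rewrite normrM mulrC ler_pM //; last exact: le_fnorm.
exact: hM.
Qed.

Lemma box_lipschitz r (W : normedModType R) (C : frame W) (F : V -> W) : Ck_on 1 setT F ->
  exists2 L, 0 <= L & forall x y, box r x -> box r y ->
    \sum_j `|fco C j (F x - F y)| <= L * fnorm (x - y).
Proof.
move=> cF.
have h j := @box_lipschitz_real r (fco C j \o F)
  (Ck_lin_comp openT (fco_continuous C j) cF).
exists (\sum_j s2val (cid2 (h j))); first by apply: sumr_ge0 => i _; case: cid2.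
move=> x y bx by_; rewrite mulr_suml; apply: ler_sum => j _.
by case: cid2 => L /= _ hL; rewrite linearB; exact: hL.
Qed.

Definition clip (r a : R) : R := Num.max (- r) (Num.min a r).

Lemma clip_bound r a : 0 <= r -> `|clip r a| <= r.
Proof.
move=> r0; rewrite ler_norml /clip le_max lexx /= ge_max ge_min lexx orbT andbT; lra.
Qed.

Lemma clip_id r a : `|a| <= r -> clip r a = a.
Proof.
rewrite ler_norml => /andP[h1 h2]; rewrite /clip (min_idPl h2).
by apply/max_idPr.
Qed.

Lemma clip_lipschitz r a b : `|clip r a - clip r b| <= `|a - b|.
Proof.
rewrite /clip; have := ler_norm (a - b); have := ler_norm (b - a); rewrite (distrC b a).
move=> h1 h2; rewrite ler_norml; apply/andP.
by case: (leP a r); case: (leP b r) => ? ?;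
  (repeat match goal with |- context [Order.max ?u ?v] => case: (leP u v) => ? end); split; lra.
Qed.

(** For r >= 0 this retracts V onto the box and is 1-Lipschitz for [fnorm]. Composed with it, a C^1
    field becomes bounded and globally Lipschitz while keeping its values on the box. *)
Definition clamp r x : V := \sum_i clip r (fco B i x) *: fvec B i.

Lemma co_clamp r x i : fco B i (clamp r x) = clip r (fco B i x).
Proof.
rewrite /clamp linear_sum (bigD1 i) //= linearZ /= fco_vec eqxx /GRing.scale /= mulr1.
rewrite big1 ?addr0 // => j ji; rewrite linearZ /= fco_vec eq_sym (negPf ji).
by rewrite /GRing.scale /= mulr0.
Qed.

Lemma box_clamp r x : 0 <= r -> box r (clamp r x).
Proof. by move=> r0 i; rewrite co_clamp clip_bound. Qed.

Lemma clamp_id r x : box r x -> clamp r x = x.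
Proof. by move=> bx; apply: (frame_eq (B := B)) => i; rewrite co_clamp clip_id. Qed.

Lemma clamp_lipschitz r x y : fnorm (clamp r x - clamp r y) <= fnorm (x - y).
Proof. by apply: ler_sum => i _; rewrite !linearB /= !co_clamp clip_lipschitz. Qed.

End FrameNorm.

(** * Gronwall's inequality for curves in V *)

Section VectorGronwall.
Context {R : realType} {V : normedModType R} (B : frame V).

Lemma is_derive_bigsum (W : normedModType R) I (r : seq I) (h : I -> R -> W) (t : R) dh :
  (forall i, is_derive t 1 (h i) (dh i)) ->
  is_derive t 1 (fun s => \sum_(i <- r) h i s) (\sum_(i <- r) dh i).
Proof.
move=> H; elim: r => [|i r IH].
  rewrite big_nil (_ : (fun _ => _) = cst 0); first exact: is_derive_cst.
  by apply/funext => s; rewrite big_nil.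
rewrite big_cons (_ : (fun _ => _) = h i + (fun s => \sum_(j <- r) h j s)).
  exact: is_deriveD.
by apply/funext => s; rewrite big_cons.
Qed.

Lemma is_derive_lin_comp (W X : normedModType R) (L : {linear W -> X}) (c : R -> W) (t : R) d :
  continuous L -> is_derive t 1 c d -> is_derive t 1 (L \o c) (L d).
Proof.
move=> cL hc; apply: is_derive_eq.
  by apply: is_derive_curve hc _; exact: linear_differentiable.
exact: derive_lin.
Qed.

Lemma is_derive_co (c : R -> V) (t : R) d i :
  is_derive t 1 c d -> is_derive t 1 (fco B i \o c) (fco B i d).
Proof. exact: is_derive_lin_comp (fco_continuous B i). Qed.

Lemma is_derive_coords (c : R -> V) (t : R) d :
  (forall i, is_derive t 1 (fco B i \o c) (fco B i d)) -> is_derive t 1 c d.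
Proof.
move=> h; have -> : c = fun s => \sum_i scalel (fvec B i) ((fco B i \o c) s).
  by apply/funext => s; rewrite {1}[c s](frame_sum B).
rewrite [d](frame_sum B); apply: is_derive_bigsum => i.
exact: (is_derive_lin_comp (@scalel_cont R V (fvec B i)) (h i)).
Qed.

Lemma continuous_co (T : topologicalType) (c : T -> V) i : continuous c -> continuous (fco B i \o c).
Proof. by move=> cc x; apply: continuous_comp; [exact: cc|exact: fco_continuous]. Qed.

Let m : R := #|fidx B|%:R.
(** A differentiable substitute for [fnorm], comparable to its square, on which the scalar
    inequality can be run. *)
Let Q (x : V) : R := \sum_i fco B i x ^+ 2.

Lemma sqr_fnorm_le x : fnorm B x ^+ 2 <= m ^+ 2 * Q x.
Proof.
have Q0 : 0 <= Q x by apply: sumr_ge0 => i _; exact: sqr_ge0.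
rewrite -[Q x]sqr_sqrtr // -exprMn; apply: lerXn2r; rewrite ?nnegrE ?fnorm_ge0 //.
  by rewrite mulr_ge0 ?sqrtr_ge0 ?ler0n.
apply: fnorm_le => i; rewrite -sqrtr_sqr ler_wsqrtr // /Q (bigD1 i) //= lerDl.
by apply: sumr_ge0 => j _; exact: sqr_ge0.
Qed.

Lemma Q_le x : Q x <= fnorm B x ^+ 2.
Proof.
rewrite expr2 {1}/fnorm mulr_suml; apply: ler_sum => i _.
by rewrite -real_normK ?num_real // expr2 ler_wpM2l // le_fnorm.
Qed.

Lemma fnorm_gronwall (L : R) : 0 <= L -> exists2 C, 1 <= C &
  forall (T : R) (w dw : R -> V) (e : R), 0 <= T <= 2 -> 0 <= e -> continuous w ->
  (forall t, 0 < t < T -> is_derive t 1 w (dw t)) ->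
  (forall t, 0 < t < T -> fnorm B (dw t) <= L * fnorm B (w t) + e) ->
  fnorm B (w T) <= C * (fnorm B (w 0) + e).
Proof.
move=> L0; pose A := (2 * L + 1) * m ^+ 2; pose E := expR (A * 2).
have m0 : 0 <= m by exact: ler0n.
have A0 : 0 <= A by rewrite mulr_ge0 ?sqr_ge0 //; lra.
have E1 : 1 <= E.
  by apply: le_trans (expR_ge1Dx _); rewrite lerDl mulr_ge0.
(* Twice E comes from 4 E^2 under the square root at the end; m + 1 instead of m keeps the constant
   at least 1 in dimension zero too. *)
exists (2 * (m + 1) * E) => [|T w dw e /andP[T0 T2] e0 cw hw Hw]; first nra.
have cQ : continuous (Q \o w).
  suff h : Ck_on 0 setT (fun t => \sum_i (fco B i \o w) t * (fco B i \o w) t).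
    by move=> t; exact: (h t I).
  apply: Ck_sum => [|i]; first exact: openT.
  have ci : Ck_on 0 setT (fco B i \o w) by move=> t _; exact: (continuous_co (i := i) cw).
  by apply: Ck_mul => //; exact: openT.
have hQ t : 0 < t < T ->
    is_derive t 1 (Q \o w) (\sum_i 2 * (fco B i (w t) * fco B i (dw t))).
  move=> tT; apply: is_derive_bigsum => i.
  have hi := is_derive_co i (hw t tT).
  rewrite (_ : (fun s => _) = (fco B i \o w) * (fco B i \o w)); last first.
    by apply/funext => s; rewrite expr2.
  by apply: is_derive_eq; rewrite /= /GRing.scale /=; ring.
have HQ t : 0 < t < T -> \sum_i 2 * (fco B i (w t) * fco B i (dw t)) <= A * (Q \o w) t + e ^+ 2.
  move=> tT; apply: (@le_trans _ _ (2 * (fnorm B (w t) * fnorm B (dw t)))).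
    rewrite -mulr_sumr ler_wpM2l // {1}/fnorm mulr_suml; apply: ler_sum => i _.
    apply: le_trans (ler_norm _) _; rewrite normrM ler_wpM2l //.
    exact: le_fnorm.
  have := Hw t tT; have := fnorm_ge0 B (w t); have := sqr_fnorm_le (w t).
  rewrite /A /=; set N := fnorm B (w t); set D := fnorm B (dw t).
  move=> h1 h2 h3; have h4 : N * D <= N * (L * N + e) by rewrite ler_wpM2l.
  have : (2 * L + 1) * N ^+ 2 <= (2 * L + 1) * (m ^+ 2 * Q (w t)).
    by rewrite ler_wpM2l //; lra.
  have := sqr_ge0 (N - e); nra.
have := gronwall A0 (sqr_ge0 e) T0 (within_cont cQ) hQ HQ; rewrite subr0 /=.
have : expR (A * T) <= E by rewrite ler_expR ler_wpM2l.
have := expR_ge0 (A * T); have := Q_le (w 0); have := sqr_fnorm_le (w T).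
have := fnorm_ge0 B (w 0); have := fnorm_ge0 B (w T).
have Q0 : 0 <= Q (w 0) by apply: sumr_ge0 => i _; exact: sqr_ge0.
set N := fnorm B (w T); set N0 := fnorm B (w 0); set X := expR _.
move=> hN hN0 h1 h2 hX h3 h4.
have k1 : Q (w T) <= E * (N0 ^+ 2 + 2 * e ^+ 2).
  apply: (le_trans h4); apply: ler_pM => //; first by rewrite addr_ge0 // mulr_ge0 ?sqr_ge0.
  by apply: lerD => //; rewrite mulrC ler_wpM2r // sqr_ge0.
have k2 : N ^+ 2 <= m ^+ 2 * (E * (N0 ^+ 2 + 2 * e ^+ 2)).
  by apply: (le_trans h1); rewrite ler_wpM2l // sqr_ge0.
have E0 : 0 <= E by lra.
have s0 : 0 <= N0 ^+ 2 + 2 * e ^+ 2 by have := sqr_ge0 N0; have := sqr_ge0 e; lra.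
have k3 : N0 ^+ 2 + 2 * e ^+ 2 <= (4 * E) * (N0 + e) ^+ 2.
  have ne : 0 <= N0 * e by rewrite mulr_ge0.
  have : 4 * 1 * (N0 + e) ^+ 2 <= 4 * E * (N0 + e) ^+ 2.
    by rewrite ler_wpM2r ?sqr_ge0 //; lra.
  by have := sqr_ge0 N0; have := sqr_ge0 e; rewrite sqrrD; lra.
have k4 : m ^+ 2 <= (m + 1) ^+ 2 by rewrite sqrrD; lra.
rewrite -(@ler_pXn2r _ 2) // ?nnegrE //; last first.
  by rewrite !mulr_ge0 //; lra.
apply: (le_trans k2).
have -> : (2 * (m + 1) * E * (N0 + e)) ^+ 2 =
  ((m + 1) ^+ 2 * (E * ((4 * E) * (N0 + e) ^+ 2))) by ring.
by apply: ler_pM => //; rewrite ?sqr_ge0 ?mulr_ge0 // ler_wpM2l.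
Qed.

End VectorGronwall.

(** * Primitives of curves *)

Section Primitive.
Context {R : realType}.

(** Clipping time to [0, 2] makes primitives constant outside that interval, hence Lipschitz on all
    of R. *)
Definition tclip (t : R) : R := Num.max 0 (Num.min t 2).

Lemma tclip_itv t : 0 <= tclip t <= 2.
Proof. by rewrite /tclip le_max lexx /= ge_max ge_min lexx orbT andbT. Qed.

Lemma tclip_id t : 0 <= t <= 2 -> tclip t = t.
Proof. by move=> /andP[t0 t2]; rewrite /tclip (min_idPl t2); apply/max_idPr. Qed.

Lemma tclip_lipschitz s t : `|tclip s - tclip t| <= `|s - t|.
Proof.
rewrite /tclip; have := ler_norm (s - t); have := ler_norm (t - s); rewrite (distrC t s).
move=> h1 h2; rewrite ler_norml; apply/andP.
by case: (leP s 2); case: (leP t 2) => ? ?;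
  (repeat match goal with |- context [Order.max ?u ?v] => case: (leP u v) => ? end); split; lra.
Qed.

Lemma primitive_real (phi : R -> R) (M : R) : continuous phi -> (forall t, `|phi t| <= M) ->
  exists Phi : R -> R, [/\ Phi 0 = 0, forall t, Phi t = Phi (tclip t),
    forall s t, `|Phi s - Phi t| <= M * `|s - t| &
    forall t : R, 0 < t < 2 -> is_derive t 1 Phi (phi t)].
Proof.
move=> cphi bphi.
have M0 : 0 <= M by apply: le_trans (bphi 0).
(* Integrating from -1 and up to 3 makes G differentiable on an open interval around [0, 2], so the
   end points need no special care. *)
pose G (y : R) := (\int[lebesgue_measure]_(t in [set` `[(-1)%R, y]]) (phi t))%R.
have iphi : lebesgue_measure.-integrable `[(-1)%R, 3] (EFin \o phi).
  by apply: continuous_compact_integrable; [exact: segment_compact|exact: within_cont].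
have hG (t : R) : -1 < t < 3 -> is_derive t 1 G (phi t).
  move=> /andP[t1 t3].
  have [dG GE] := continuous_FTC1_closed t3 iphi t1 (cphi t).
  by apply: DeriveDef; [exact: dG|rewrite -derive1E; exact: GE].
have cG (t : R) : -1 < t < 3 -> {for t, continuous G}.
  move=> /hG [dG _]; exact/differentiable_continuous/derivable1_diffP.
exists (fun t => G (tclip t) - G 0); split=> [|t|s t|t /andP[t0 t2]].
- by rewrite tclip_id ?subrr // lexx ler0n.
- by rewrite (tclip_id (tclip_itv t)).
- have lip a b : a <= b -> 0 <= a <= 2 -> 0 <= b <= 2 -> `|G b - G a| <= M * (b - a).
    move=> ab /andP[a0 a2] /andP[b0 b2].
    apply: (@increment_bound _ G phi) => // [|u /andP[ua ub]].
      apply: continuous_in_subspaceT => u; rewrite inE /= in_itv /= => /andP[ua ub].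
      by apply: cG; apply/andP; split; lra.
    by apply: hG; apply/andP; split; lra.
  rewrite opprB addrA subrK.
  apply: le_trans (ler_wpM2l M0 (tclip_lipschitz s t)).
  have [st|ts] := leP (tclip t) (tclip s).
    by rewrite [X in _ * X]ger0_norm ?subr_ge0 //; apply: lip => //; exact: tclip_itv.
  rewrite distrC (distrC (tclip s)) [X in _ * X]ger0_norm ?subr_ge0 ?(ltW ts) //.
  by apply: lip; rewrite ?tclip_itv // ltW.
- have dt : -1 < t < 3 by apply/andP; split; lra.
  have hGt := hG t dt.
  have : is_derive t 1 (fun s => G s - G 0) (phi t).
    by apply: is_derive_eq; rewrite subr0.
  apply: near_eq_is_derive.
  have : \forall s \near t, s \in `]0, 2[ by apply: near_in_itvoo; rewrite in_itv /= t0 t2.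
  apply: filterS => s; rewrite in_itv /= => /andP[s0 s2].
  by rewrite tclip_id // !ltW.
Qed.

Context {V : normedModType R} (B : frame V).

Lemma fnorm_continuous (T : topologicalType) (c : T -> V) :
  (forall x e, 0 < e -> \forall y \near x, fnorm B (c x - c y) < e) -> continuous c.
Proof.
move=> h x; apply/cvgrPdist_lt => e e0; have [K K0 hK] := norm_le_fnorm B.
have := h x (e / K) (divr_gt0 e0 K0); apply: filterS => y hy.
by apply: (le_lt_trans (hK _)); rewrite mulrC -ltr_pdivlMr.
Qed.

Lemma lipschitz_continuous (c : R -> V) K : (forall s t, fnorm B (c s - c t) <= K * `|s - t|) ->
  continuous c.
Proof.
move=> cK; apply: fnorm_continuous => t e e0.
have K1 : 0 < `|K| + 1 by rewrite ltr_pwDr.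
have : \forall s \near t, `|t - s| < e / (`|K| + 1).
  by apply: (@nbhsx_ballx R R t); exact: divr_gt0.
apply: filterS => s hs; apply: (le_lt_trans (cK _ _)).
rewrite ltr_pdivlMr // in hs; apply: le_lt_trans hs; rewrite mulrC ler_wpM2l //.
by apply: (le_trans (ler_norm _)); rewrite lerDl.
Qed.

Lemma primitive (phi : R -> V) (M : R) : continuous phi -> (forall t, fnorm B (phi t) <= M) ->
  exists Phi : R -> V, [/\ Phi 0 = 0, forall t, Phi t = Phi (tclip t),
    forall s t, fnorm B (Phi s - Phi t) <= #|fidx B|%:R * M * `|s - t| &
    forall t : R, 0 < t < 2 -> is_derive t 1 Phi (phi t)].
Proof.
move=> cphi bphi.
have h i : {P : R -> R | [/\ P 0 = 0, forall t, P t = P (tclip t),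
    forall s t, `|P s - P t| <= M * `|s - t| &
    forall t : R, 0 < t < 2 -> is_derive t 1 P (fco B i (phi t))]}.
  apply: cid; apply: primitive_real; first exact: continuous_co.
  by move=> t; exact: le_trans (le_fnorm i _) (bphi t).
pose Phi t : V := \sum_i sval (h i) t *: fvec B i.
have coP i t : fco B i (Phi t) = sval (h i) t.
  rewrite /Phi linear_sum (bigD1 i) //= linearZ /= fco_vec eqxx /GRing.scale /= mulr1.
  rewrite big1 ?addr0 // => j ji; rewrite linearZ /= fco_vec eq_sym (negPf ji).
  by rewrite /GRing.scale /= mulr0.
exists Phi; split=> [|t|s t|t t02].
- by apply: (frame_eq (B := B)) => i; rewrite coP linear0; case: (h i) => ? [].
- by apply: (frame_eq (B := B)) => i; rewrite !coP; case: (h i) => ? [].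
- rewrite -mulrA; apply: fnorm_le => i; rewrite linearB /= !coP.
  by case: (h i) => ? [].
- apply: (is_derive_coords (B := B)) => i.
  rewrite (_ : fco B i \o Phi = sval (h i)); last by apply/funext => s /=; rewrite coP.
  by case: (h i) => ? [? ? ?]; apply.
Qed.

End Primitive.

(** * Picard iteration for globally Lipschitz fields *)

Section Picard.
Context {R : realType}.

Lemma le_geometric (a b g : R) : (forall k, a <= b + g * 2^-1 ^+ k) -> a <= b.
Proof.
move=> h; apply/ler_addgt0Pr => e e0.
have [k gk] : exists k : nat, `|g| / e < k%:R.
  by exists (Num.bound (`|g| / e)); apply: archi_boundP; rewrite divr_ge0 // ltW.
apply: (le_trans (h k)); rewrite lerD2l; apply: (le_trans (ler_norm _)).
have k2 : (k%:R : R) <= 2 ^+ k by rewrite -natrX ler_nat ltnW // ltn_expl.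
rewrite ltr_pdivrMr // in gk.
rewrite normrM exprVn [X in _ * X]ger0_norm ?invr_ge0 ?exprn_ge0 //.
rewrite ler_pdivrMr ?exprn_gt0 //; apply: (le_trans (ltW gk)).
by rewrite mulrC ler_wpM2l // ltW.
Qed.

(** The intervals of radius 2 G 2^-k about [a k] are nested, as consecutive radii differ by exactly
    G 2^-k; l is the supremum of their left ends. *)
Lemma geometric_limit (a : nat -> R) (G : R) :
  (forall k, `|a k.+1 - a k| <= G * 2^-1 ^+ k) ->
  exists l, forall k, `|a k - l| <= 2 * G * 2^-1 ^+ k.
Proof.
move=> h; pose lo k := a k - 2 * G * 2^-1 ^+ k; pose up k := a k + 2 * G * 2^-1 ^+ k.
have G0 k : 0 <= G * 2^-1 ^+ k by apply: le_trans (h k).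
have loS k : lo k <= lo k.+1.
  by have := h k; rewrite /lo exprS ler_norml; lra.
have upS k : up k.+1 <= up k.
  by have := h k; rewrite /up exprS ler_norml; lra.
have loM i j : (i <= j)%N -> lo i <= lo j.
  elim: j => [|j IH]; first by rewrite leqn0 => /eqP ->.
  by rewrite leq_eqVlt => /predU1P[->//|/IH ij]; exact: le_trans ij (loS j).
have upM i j : (i <= j)%N -> up j <= up i.
  elim: j => [|j IH]; first by rewrite leqn0 => /eqP ->.
  by rewrite leq_eqVlt => /predU1P[->//|/IH ij]; exact: le_trans (upS j) ij.
have lu i j : lo i <= up j.
  apply: (@le_trans _ _ (lo (maxn i j))); first exact/loM/leq_maxl.
  apply: (@le_trans _ _ (up (maxn i j))); last exact/upM/leq_maxr.
  by rewrite /lo /up; have := G0 (maxn i j); lra.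
have hs : has_sup (range lo).
  by split; [exists (lo 0), 0|exists (up 0) => _ [k _ <-]].
exists (sup (range lo)) => k.
have h1 : lo k <= sup (range lo) by apply: ub_le_sup; [case: hs|exists k].
have h2 : sup (range lo) <= up k.
  by apply: ge_sup => [|_ [i _ <-]]; [case: hs|].
by move: h1 h2; rewrite ler_norml /lo /up => h1 h2; apply/andP; split; lra.
Qed.

(** Integrating the weight exp (A s) gains the factor 1 / A, which makes the Picard map a
    contraction when A is large. *)
Lemma exp_weight_bound (y dy : R -> R) (A c t : R) : 0 < A -> 0 <= t -> 0 <= c ->
  continuous y -> y 0 = 0 ->
  (forall s, 0 < s < t -> is_derive s 1 y (dy s)) ->
  (forall s, 0 < s < t -> `|dy s| <= c * expR (A * s)) ->
  `|y t| <= c / A * expR (A * t).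
Proof.
move=> A0 t0 c0 cy y0 hy Hy.
pose z (s : R) := c / A * expR (A * s).
have hz (s : R) : 0 < s < t -> is_derive s 1 z (c * expR (A * s)).
  move=> _; have ha : is_derive s 1 (fun u : R => A * u) A.
    by apply: is_derive_eq; rewrite /GRing.scale /= mulr1.
  have he := is_derive_real_comp ha (is_derive_exp (A * s)).
  have : is_derive s 1 ((c / A) \*: (expR \o (fun u : R => A * u))) (c * expR (A * s)).
    by apply: is_derive_eq; rewrite /GRing.scale /= mulrA divfK // gt_eqF.
  by [].
have cz : continuous z.
  move=> s; apply: cvgM; first exact: cvg_cst.
  apply: (@continuous_comp _ _ _ (fun u : R => A * u) expR); first exact: mulrl_continuous.
  exact: continuous_expR.
have z0 : 0 <= z 0 by rewrite /z mulr_ge0 ?expR_ge0 // divr_ge0 // ltW.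
have h1 := increment_le t0 (within_cont cy) (within_cont cz) hy hz.
have cNy : continuous (fun s : R => - y s) by move=> s; apply: continuousN; exact: cy.
have hNy s : 0 < s < t -> is_derive s 1 (fun u : R => - y u) (- dy s).
  by move=> st; apply: is_deriveN; exact: hy.
have h2 := increment_le t0 (within_cont cNy) (within_cont cz) hNy hz.
have {}h1 : y t - y 0 <= z t - z 0.
  by apply: h1 => s /Hy; rewrite ler_norml => /andP[].
have {}h2 : - y t - - y 0 <= z t - z 0.
  by apply: h2 => s /Hy; rewrite ler_norml; lra.
by rewrite -/(z t) ler_norml; rewrite y0 in h1 h2; lra.
Qed.

Context {V : normedModType R} (B : frame V).

(* Picard iteration; the weight exp (A t) makes it contract by 1/2 on the whole of [0, 2]. *)
Lemma global_flow (F : V -> V) (M L : R) (x0 : V) : 0 <= L ->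
  (forall x, fnorm B (F x) <= M) ->
  (forall x y, fnorm B (F x - F y) <= L * fnorm B (x - y)) ->
  exists c : R -> V, [/\ continuous c, c 0 = x0 &
    forall t : R, 0 < t < 2 -> is_derive t 1 c (F (c t))].
Proof.
move=> L0 FM FL; pose m : R := #|fidx B|%:R; pose K := m * M.
have m0 : 0 <= m by exact: ler0n.
have M0 : 0 <= M by apply: le_trans (FM 0); exact: fnorm_ge0.
have K0 : 0 <= K by exact: mulr_ge0.
pose adm (u : R -> V) := forall s t, fnorm B (u s - u t) <= K * `|s - t|.
have /choice[step hstep] : forall u : R -> V, exists v : R -> V, adm u -> [/\ v 0 = x0,
    forall t, v t = v (tclip t), adm v &
    forall t : R, 0 < t < 2 -> is_derive t 1 v (F (u t))].
  move=> u.
  (* [choice] needs a total map; at curves that are not K-Lipschitz its value is arbitrary. *)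
  have [au|nu] := pselect (adm u); last by exists u.
  have cFu : continuous (F \o u).
    apply: (@lipschitz_continuous _ _ B _ (L * K)) => s t.
    by rewrite -mulrA; apply: (le_trans (FL _ _)); rewrite ler_wpM2l.
  have [P [P0 Pc PL Pd]] := @primitive _ _ B _ M cFu (fun t => FM (u t)).
  exists (fun t => x0 + P t) => _; split=> [|t|s t|t t02].
  - by rewrite P0 addr0.
  - by rewrite -Pc.
  - by rewrite opprD addrACA subrr add0r.
  - have hP := Pd t t02.
    have : is_derive t 1 (cst x0 + P) (F (u t)) by apply: is_derive_eq; rewrite add0r.
    by [].
pose u k := iter k step (cst x0).
have au k : adm (u k).
  elim: k => [|k /hstep[]//]; move=> s t /=.
  by rewrite subrr fnorm0 mulr_ge0.
have uS k := hstep _ (au k).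
have u0 k : u k 0 = x0 by case: k => [|k] //; case: (uS k).
have uc k t : u k t = u k (tclip t) by case: k => [|k] //; case: (uS k) => _ h _ _; exact: h.
have cu k : continuous (u k) by apply: (@lipschitz_continuous _ _ B _ K); exact: au.
(* A is chosen so that m L / A <= 1/2. D bounds the first step: [u 1] is K-Lipschitz and starts at
   x0, and time is at most 2. *)
pose A := 2 * m * L + 1; pose E := expR (A * 2); pose D := 2 * K.
have A0 : 0 < A by rewrite ltr_wpDl // !mulr_ge0.
have D0 : 0 <= D by rewrite mulr_ge0.
have hD k t : 0 <= t <= 2 -> fnorm B (u k.+1 t - u k t) <= D * 2^-1 ^+ k * expR (A * t).
  elim: k t => [|k IH] t /andP[t0 t2].
    have -> : u 0 t = u 1 0 by rewrite u0.
    apply: (le_trans (au 1 _ _)); rewrite subr0 ger0_norm // expr0 mulr1.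
    apply: (@le_trans _ _ D); first by rewrite /D mulrC ler_wpM2r.
    rewrite ler_peMr //; apply: le_trans (expR_ge1Dx _); rewrite lerDl mulr_ge0 //.
    exact: ltW.
  have [_ _ _ d1] := uS k.+1; have [_ _ _ d0] := uS k.
  pose c := L * (D * 2^-1 ^+ k).
  have c0 : 0 <= c by rewrite !mulr_ge0 // exprn_ge0 // invr_ge0.
  have hi i : `|fco B i (u k.+2 t - u k.+1 t)| <= c / A * expR (A * t).
    apply: (@exp_weight_bound (fun s => fco B i (u k.+2 s - u k.+1 s))
      (fun s => fco B i (F (u k.+1 s) - F (u k s))) A c t A0 t0 c0).
    - apply: (continuous_co (c := fun s => u k.+2 s - u k.+1 s)) => s.
      by apply: cvgB; exact: cu.
    - by rewrite !u0 subrr linear0.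
    - move=> s /andP[s0 st]; have s2 : 0 < s < 2 by rewrite s0 (lt_le_trans st).
      apply: (is_derive_co (c := fun s => u k.+2 s - u k.+1 s)).
      by apply: is_deriveB; [exact: d1|exact: d0].
    - move=> s /andP[s0 st]; apply: (le_trans (le_fnorm i _)).
      apply: (le_trans (FL _ _)); rewrite /c -mulrA ler_wpM2l // IH //.
      by rewrite (ltW s0) /= (le_trans (ltW st)).
  apply: (le_trans (fnorm_le hi)); rewrite mulrA ler_wpM2r ?expR_ge0 //.
  rewrite /c exprS -/m.
  have -> : m * (L * (D * 2^-1 ^+ k) / A) = (m * L / A) * (D * 2^-1 ^+ k) by ring.
  have -> : D * (2^-1 * 2^-1 ^+ k) = 2^-1 * (D * 2^-1 ^+ k) by ring.
  rewrite ler_wpM2r ?mulr_ge0 ?exprn_ge0 ?invr_ge0 //.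
  have mL : 0 <= m * L by exact: mulr_ge0.
  by rewrite ler_pdivrMr // /A; lra.
have hDE k t : fnorm B (u k.+1 t - u k t) <= D * E * 2^-1 ^+ k.
  rewrite uc [u k t]uc; have /andP[c0 c2] := tclip_itv t.
  apply: (le_trans (hD k _ (tclip_itv t))); rewrite mulrAC ler_wpM2r ?exprn_ge0 ?invr_ge0 //.
  by rewrite ler_wpM2l // ler_expR ler_wpM2l // ltW.
pose G := 2 * (D * E).
have /choice[c hc] : forall t, exists ct, forall k,
    fnorm B (u k t - ct) <= m * G * 2^-1 ^+ k.
  move=> t.
  have h i : {l | forall k, `|fco B i (u k t) - l| <= G * 2^-1 ^+ k}.
    apply: cid; apply: geometric_limit => k; rewrite -linearB.
    exact: le_trans (le_fnorm i _) (hDE k t).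
  exists (\sum_i sval (h i) *: fvec B i) => k; rewrite -mulrA.
  apply: fnorm_le => i; rewrite linearB /= linear_sum (bigD1 i) //= linearZ /= fco_vec eqxx.
  rewrite /GRing.scale /= mulr1 big1 ?addr0 => [|j ji]; first by case: (h i) => l /=; exact.
  by rewrite linearZ /= fco_vec eq_sym (negPf ji) /GRing.scale /= mulr0.
have ac : adm c.
  move=> s t; apply: (@le_geometric _ _ (2 * (m * G))) => k.
  apply: (le_trans (fnorm_dist B _ (u k s) _)); rewrite addrC.
  apply: (le_trans (lerD (fnorm_dist B _ (u k t) _) (lexx _))).
  rewrite (fnormB B (c s)); have := hc s k; have := hc t k; have := au k s t.
  set a := fnorm B _; set b := fnorm B _; set d := fnorm B _; lra.
have [w0 wc aw dw] := hstep _ ac.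
have cw : continuous (step c) by apply: (@lipschitz_continuous _ _ B _ K).
have G0 k : 0 <= m * G * 2^-1 ^+ k.
  by rewrite !mulr_ge0 ?exprn_ge0 ?invr_ge0 ?expR_ge0.
(* Both sides are within a multiple of 2^-k of [u k.+1]: the right side by the choice of c, the left
   side because F is Lipschitz and c is close to [u k]. *)
have cE : step c = c.
  apply/funext => t; apply/eqP; rewrite -subr_eq0; apply/eqP.
  apply: (@fnorm_le0 _ _ B).
  apply: (@le_geometric _ _ (m * (L * (m * G) * 2) + m * G)) => k; rewrite add0r.
  rewrite mulrDl; apply: (le_trans (fnorm_dist B _ (u k.+1 t) _)); apply: lerD; last first.
    apply: (le_trans (hc t k.+1)); rewrite exprS.
    by have := G0 k; lra.
  rewrite fnormB wc uc; have /andP[t0 t2] := tclip_itv t.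
  rewrite -mulrA; apply: fnorm_le => i.
  have [_ _ _ d0] := uS k.
  have := @increment_bound _ (fun s => fco B i (u k.+1 s - step c s))
    (fun s => fco B i (F (u k s) - F (c s))) 0 (tclip t) (L * (m * G * 2^-1 ^+ k)) t0.
  rewrite w0 u0 subrr linear0 subr0 subr0 => h; apply: le_trans (h _ _ _) _.
  - apply: within_cont; apply: (continuous_co (c := fun s => u k.+1 s - step c s)) => s.
    by apply: cvgB; [exact: cu|exact: cw].
  - move=> s /andP[s0 st]; have s2 : 0 < s < 2 by rewrite s0 (lt_le_trans st).
    apply: (is_derive_co (c := fun s => u k.+1 s - step c s)).
    by apply: is_deriveB; [exact: d0|exact: dw].
  - move=> s _; apply: (le_trans (le_fnorm i _)).
    by apply: (le_trans (FL _ _)); rewrite ler_wpM2l.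
  - have : 0 <= L * (m * G * 2^-1 ^+ k) by rewrite mulr_ge0.
    nra.
by exists c; rewrite -cE; split => // t t02; rewrite {2}cE; exact: dw.
Qed.

End Picard.

(** * Flow lines of C^1 fields: uniqueness and continuation *)

Section FlowLines.
Context {R : realType} {V : normedModType R} (B : frame V).
Implicit Types (F : V -> V) (c d : R -> V) (T : R).

(** The equation is imposed at interior times and continuity carries it to the end points, so
    one-sided derivatives never occur. *)
Definition flow_line F T c : Prop :=
  continuous c /\ forall t : R, 0 < t < T -> is_derive t 1 c (F (c t)).

Lemma flow_line_sub F T S c : S <= T -> flow_line F T c -> flow_line F S c.
Proof.
move=> ST [cc hc]; split=> // t /andP[t0 tS]; apply: hc.
by rewrite t0 (lt_le_trans tS).
Qed.

Lemma flow_line_eq F G T c : (forall t, 0 < t < T -> F (c t) = G (c t)) ->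
  flow_line F T c -> flow_line G T c.
Proof. by move=> FG [cc hc]; split=> // t tT; rewrite -FG //; exact: hc. Qed.

Lemma curve_bounded c : continuous c ->
  exists2 r, 0 <= r & forall t, 0 <= t <= 2 -> box B r (c t).
Proof.
move=> cc.
have h (i : fidx B) := bounded_on_compact (@segment_compact R 0 2) (continuous_co (i := i) cc).
exists (\sum_i s2val (cid2 (h i))) => [|t t02 i].
  by apply: sumr_ge0 => i _; case: cid2.
apply: (@le_trans _ _ (s2val (cid2 (h i)))).
  by case: cid2 => M /= _; apply; rewrite /= in_itv.
by rewrite (bigD1 i) //= lerDl sumr_ge0 // => j _; case: cid2.
Qed.

Lemma flow_line_dist F (A : set V) (L : R) : 0 <= L ->
  (forall x y, A x -> A y -> fnorm B (F x - F y) <= L * fnorm B (x - y)) ->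
  exists2 C, 1 <= C & forall T c d, T <= 2 -> flow_line F T c -> flow_line F T d ->
  (forall t, 0 < t < T -> A (c t)) -> (forall t, 0 < t < T -> A (d t)) ->
  forall t, 0 <= t <= T -> fnorm B (c t - d t) <= C * fnorm B (c 0 - d 0).
Proof.
move=> L0 FL; have [C C1 hC] := fnorm_gronwall B L0.
exists C => // T c d T2 [cc hc] [cd hd] Ac Ad t /andP[t0 tT].
have := hC t (fun s => c s - d s) (fun s => F (c s) - F (d s)) 0.
rewrite addr0; apply=> //; first by rewrite t0 (le_trans tT).
- by move=> s; apply: cvgB; [exact: cc|exact: cd].
- move=> s /andP[s0 st]; have sT : 0 < s < T by rewrite s0 (lt_le_trans st).
  by apply: is_deriveB; [exact: hc|exact: hd].
- move=> s /andP[s0 st]; have sT : 0 < s < T by rewrite s0 (lt_le_trans st).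
  by rewrite addr0; apply: FL; [exact: Ac|exact: Ad].
Qed.

(** Two continuous curves stay in a common box during [0, 2], and a C^1 field is Lipschitz on a
    box. *)
Lemma flow_line_unique F T c d : Ck_on 1 setT F -> T <= 2 ->
  flow_line F T c -> flow_line F T d -> c 0 = d 0 ->
  forall t, 0 <= t <= T -> c t = d t.
Proof.
move=> cF T2 hc hd cd0 t tT.
have [r r0 hr] := curve_bounded (proj1 hc); have [s s0 hs] := curve_bounded (proj1 hd).
have [L L0 FL] := box_lipschitz B (r + s) B cF.
have [C _ hC] := flow_line_dist L0 FL.
have boxT u v x : 0 <= v -> box B u x -> box B (u + v) x.
  by move=> v0 bx i; apply: (le_trans (bx i)); rewrite lerDl.
have le2 w : 0 < w < T -> 0 <= w <= 2.
  by move=> /andP[w0 wT]; rewrite (ltW w0) (le_trans (ltW wT)).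
have := hC T c d T2 hc hd.
rewrite cd0 subrr fnorm0 mulr0 => h.
apply/eqP; rewrite -subr_eq0; apply/eqP; apply: (@fnorm_le0 _ _ B); apply: h => // w wT.
  by apply: boxT => //; apply: hr; exact: le2.
by rewrite addrC; apply: boxT => //; apply: hs; exact: le2.
Qed.

Lemma clamped_field F r : Ck_on 1 setT F -> 0 <= r -> exists2 L, 0 <= L &
  (forall x y, fnorm B (F (clamp B r x) - F (clamp B r y)) <= L * fnorm B (x - y)) /\
  (forall x0, exists2 c, flow_line (F \o clamp B r) 2 c & c 0 = x0).
Proof.
move=> cF r0; have [L L0 FL] := box_lipschitz B r B cF.
have GL x y : fnorm B (F (clamp B r x) - F (clamp B r y)) <= L * fnorm B (x - y).
  apply: (le_trans (FL _ _ (box_clamp _ r0) (box_clamp _ r0))).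
  by rewrite ler_wpM2l // clamp_lipschitz.
exists L => //; split => // x0.
have h (i : fidx B) := bounded_on_compact (box_compact B r)
  (fun x => Ck_continuous (Ck_lin_comp openT (fco_continuous B i) cF) (I : setT x)).
pose M := \sum_i s2val (cid2 (h i)).
have FM x : fnorm B (F (clamp B r x)) <= M.
  by apply: ler_sum => i _; case: cid2 => N /= _; apply; exact: box_clamp.
have [c [cc c0 hc]] := global_flow x0 L0 FM GL.
by exists c.
Qed.

(* A flow line can only fail to reach time 1 by leaving every box. *)
Lemma flow_line_continuation F x0 : Ck_on 1 setT F ->
  (forall tau, 0 < tau <= 1 ->
     (forall T, 0 <= T < tau -> exists2 c, flow_line F T c & c 0 = x0) ->
     exists rho, forall T c, 0 <= T < tau -> flow_line F T c -> c 0 = x0 -> box B rho (c T)) ->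
  exists2 c, flow_line F 1 c & c 0 = x0.
Proof.
move=> cF Hb.
pose S := [set T | 0 <= T <= 1 /\ exists2 c, flow_line F T c & c 0 = x0].
have S0 : S 0.
  split; first by rewrite lexx ler01.
  exists (cst x0) => //; split; first by move=> t; exact: cvg_cst.
  by move=> t /andP[t0 /(lt_trans t0)]; rewrite ltxx.
have hS : has_sup S by split; [exists 0|exists 1 => T [/andP[]]].
pose tau := sup S.
have tau0 : 0 <= tau by apply: ub_le_sup; [case: hS|].
have tau1 : tau <= 1 by apply: ge_sup => [|T [/andP[]]] //; case: hS.
have [rho [hrho0 hrho]] : exists rho, box B rho x0 /\
    forall T c, 0 <= T < tau -> flow_line F T c -> c 0 = x0 -> box B rho (c T).
  have b0 : box B (fnorm B x0) x0 by move=> i; exact: le_fnorm.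
  have [tp|] := ltP 0 tau; last first.
    move=> tn; exists (fnorm B x0); split=> // T c /andP[T0 /(le_lt_trans T0)].
    by rewrite ltNge tn.
  have [||rho hr] := Hb tau; first by rewrite tp.
    move=> T /andP[T0 Ttau]; have tT : 0 < tau - T by rewrite subr_gt0.
    have [T' [_ [c hc c0]]] := sup_adherent tT hS; rewrite subKr => TT'.
    by exists c => //; exact: flow_line_sub (ltW TT') hc.
  exists (Num.max rho (fnorm B x0)); split.
    by move=> i; apply: (le_trans (b0 i)); rewrite le_max lexx orbT.
  by move=> T c hT hc c0 i; apply: (le_trans (hr T c hT hc c0 i)); rewrite le_max lexx.
pose r := `|rho| + 1; have r0 : 0 <= r by rewrite addr_ge0.
have rr x : box B rho x -> box B r x.
  move=> bx i; apply: (le_trans (bx i)); apply: (le_trans (ler_norm _)).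
  by rewrite lerDl.
have [L L0 [GL hex]] := clamped_field cF r0.
have [d hd d0] := hex x0.
have [C _ hC] := flow_line_dist (A := setT) L0 (fun x y _ _ => GL x y).
(* Before time tau the line d of the clamped field agrees with the lines c of F, because these stay
   in a box where clamping does nothing. *)
have dbox t : 0 <= t < tau -> box B rho (d t).
  move=> /andP[t0 tt].
  have tt0 : 0 < tau - t by rewrite subr_gt0.
  have [T [/andP[T0 T1] [c hc c0]]] := sup_adherent tt0 hS; rewrite subKr => tT.
  have Ttau : T <= tau by apply: ub_le_sup; [case: hS|split; [rewrite T0|exists c]].
  have cbox s : 0 <= s < T -> box B rho (c s).
    move=> /andP[s0 sT]; apply: hrho => //; first by rewrite s0 (lt_le_trans sT).
    exact: flow_line_sub (ltW sT) hc.
  have hc' : flow_line (F \o clamp B r) T c.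
    apply: flow_line_eq hc => s /andP[s0 sT] /=.
    by rewrite clamp_id //; apply: rr; apply: cbox; rewrite (ltW s0).
  have T2 : T <= 2 by lra.
  have := hC T c d T2 hc' (flow_line_sub T2 hd) (fun _ _ => I) (fun _ _ => I) t.
  rewrite c0 d0 subrr fnorm0 mulr0 t0 (ltW tT) => /(_ isT)/fnorm_le0/eqP.
  by rewrite subr_eq0 => /eqP <-; apply: cbox; rewrite t0.
(* Two moves of less than 1/2, from [d t0] to [d tau] and on to [d t], fit into the margin between
   rho and r. *)
have [e e0 he] : exists2 e : R, 0 < e & forall t : R, `|tau - t| < e -> fnorm B (d tau - d t) < 2^-1.
  have [K K0 hK] := fnorm_le_norm B.
  have K2 : 0 < 2^-1 / K :> R by rewrite divr_gt0.
  have cd := proj1 hd; have /cvgrPdist_lt /(_ _ K2) := cd tau.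
  move=> /nbhs_ballP[e /= e0 he]; exists e => // t te.
  by apply: (le_lt_trans (hK _)); rewrite mulrC -ltr_pdivlMr //; exact: he.
have [t0 /andP[t00 t0tau] [t0e bt0]] : exists2 t0 : R, 0 <= t0 <= tau & `|tau - t0| < e /\ box B rho (d t0).
  have [tp|tn] := ltP 0 tau; last first.
    exists 0; first by rewrite lexx.
    by rewrite d0 subr0 (_ : tau = 0) ?normr0 //; apply/eqP; rewrite eq_le tn.
  have [te|te] := leP (e / 2) tau.
    exists (tau - e / 2); first by apply/andP; split; lra.
    split; first by rewrite subKr ger0_norm; lra.
    by apply: dbox; apply/andP; split; lra.
  exists 0; first by rewrite lexx.
  by rewrite d0 subr0 ger0_norm //; split => //; lra.
have dr t : 0 <= t < tau + e -> box B r (d t).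
  move=> /andP[tp tt]; have [ttau|taut] := ltP t tau.
    by apply: rr; apply: dbox; rewrite tp.
  have h1 : fnorm B (d tau - d t) < 2^-1 by apply: he; rewrite ler0_norm; lra.
  have h2 := he t0 t0e; move=> i.
  have -> : d t = d t0 + ((d tau - d t0) - (d tau - d t)).
    by rewrite opprB (addrC (d tau - _)) subrKA addrC subrK.
  rewrite linearD linearB /=; have := bt0 i; have := le_fnorm i (d tau - d t0).
  have := le_fnorm i (d tau - d t); have := ler_norm rho.
  rewrite /r !ler_norml; lra.
(* If tau + e < 1, then d solves the original equation up to tau + e / 2, contradicting the choice
   of tau as a supremum. *)
have [e1|e1] := ltP (tau + e) 1.
  have : tau + e / 2 <= tau.
    apply: ub_le_sup; first by case: hS.
    split; first by apply/andP; split; lra.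
    exists d => //; have h2 : tau + e / 2 <= 2 by lra.
    apply: flow_line_eq (flow_line_sub h2 hd) => t /andP[tp tt] /=.
    by rewrite clamp_id //; apply: dr; apply/andP; split; lra.
  by move=> h; exfalso; lra.
exists d => //; have h2 : 1 <= 2 :> R by lra.
apply: flow_line_eq (flow_line_sub h2 hd) => t /andP[tp tt] /=.
by rewrite clamp_id //; apply: dr; apply/andP; split; lra.
Qed.

End FlowLines.

(** * First and second order bounds for smooth fields *)

Section Variation.
Context {R : realType} {V : normedModType R} (B : frame V).

Lemma smooth_C1 (W : normedModType R) (F : V -> W) : smooth F -> Ck_on 1 setT F.
Proof. by move=> sF; exact: sF. Qed.

Lemma smooth_differentiable (W : normedModType R) (F : V -> W) x : smooth F -> differentiable F x.
Proof. by move=> sF; have [dF _] := sF 1; exact: dF. Qed.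

Lemma derive_fnorm_bound r (F : V -> V) : smooth F ->
  exists2 M, 0 <= M & forall x v, box B r x -> fnorm B ('D_v F x) <= M * fnorm B v.
Proof.
move=> sF.
have h (ij : fidx B * fidx B) := bounded_on_compact (box_compact B r)
  (fun x => Ck_continuous (Ck_lin_comp openT (fco_continuous B ij.1)
    ((sF 1).2 (fvec B ij.2) : Ck_on 0 setT _)) (I : setT x)).
pose m ij := s2val (cid2 (h ij)).
have m0 ij : 0 <= m ij by rewrite /m; case: cid2.
have hm ij x : box B r x -> `|fco B ij.1 ('D_(fvec B ij.2) F x)| <= m ij.
  by rewrite /m; case: cid2 => M /= _; exact.
exists (\sum_j \sum_i m (j, i)) => [|x v bx].
  by apply: sumr_ge0 => i _; apply: sumr_ge0.
rewrite mulr_suml {1}/fnorm; apply: ler_sum => j _.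
rewrite (derive_frame B _ (smooth_differentiable x sF)) linear_sum mulr_suml.
apply: (le_trans (ler_norm_sum _ _ _)); apply: ler_sum => i _.
by rewrite linearZ normrM mulrC ler_pM // ?le_fnorm //; exact: (hm (j, i)).
Qed.

(** By the mean value theorem the remainder is the change of the derivative between y and a point of
    the segment, and the derivative is Lipschitz on the box. *)
Lemma taylor_bound r (F : V -> V) : smooth F -> exists2 M, 0 <= M &
  forall x y, box B r x -> box B r y ->
    fnorm B (F x - F y - 'D_(x - y) F y) <= M * fnorm B (x - y) ^+ 2.
Proof.
move=> sF.
have h (ij : fidx B * fidx B) := @box_lipschitz_real R V B r _
  (Ck_lin_comp openT (fco_continuous B ij.1) ((sF 2).2 (fvec B ij.2) : Ck_on 1 setT _)).
pose m ij := s2val (cid2 (h ij)).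
have m0 ij : 0 <= m ij by rewrite /m; case: cid2.
have hm ij x y : box B r x -> box B r y ->
    `|fco B ij.1 ('D_(fvec B ij.2) F x) - fco B ij.1 ('D_(fvec B ij.2) F y)| <=
      m ij * fnorm B (x - y).
  by rewrite /m; case: cid2 => M /= _; exact.
exists (\sum_j \sum_i m (j, i)) => [|x y bx by_].
  by apply: sumr_ge0 => i _; apply: sumr_ge0.
have dF z := smooth_differentiable z sF.
have dcF j z : differentiable (fco B j \o F) z.
  by apply: differentiable_comp; [exact: dF|exact/linear_differentiable/fco_continuous].
have DcF j z v : 'D_v (fco B j \o F) z = fco B j ('D_v F z).
  rewrite (deriveE _ (dcF j z)) diff_comp //; last exact/linear_differentiable/fco_continuous.
  by rewrite /= (diff_lin _ (fco_continuous B j)) -(deriveE _ (dF z)).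
rewrite mulr_suml {1}/fnorm; apply: ler_sum => j _.
rewrite !linearB /=.
have [t t01] := mean_value x y (dcF j); rewrite /= => ->.
set z := y + _; have bz : box B r z by exact: box_segment.
rewrite DcF (derive_frame B _ (dF z)) (derive_frame B _ (dF y)) 2!(linear_sum (fco B j)) -sumrB mulr_suml.
apply: (le_trans (ler_norm_sum _ _ _)); apply: ler_sum => i _.
rewrite 2!(linearZZ (fco B j)) -scalerBr normrZ expr2 mulrA [m _ * _]mulrC -mulrA.
apply: ler_pM => //; first exact: le_fnorm.
apply: (le_trans (hm (j, i) z y bz by_)); rewrite ler_wpM2l //.
rewrite /z addrAC subrr add0r; apply: ler_sum => k _; rewrite linearZ normrM /=.
by rewrite ler_piMl // ger0_norm; case/andP: t01.
Qed.

End Variation.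

(** * Smooth dependence on the initial point *)

Section Dependence.
Context {R : realType}.

Lemma is_derive_pair_curve (V W : normedModType R) (c : R -> V) (d : R -> W) (t : R) dc dd :
  is_derive t 1 c dc -> is_derive t 1 d dd ->
  is_derive t 1 (fun s => (c s, d s)) (dc, dd).
Proof.
move=> [hc <-] [hd <-]; have /derivable1_diffP gc := hc; have /derivable1_diffP gd := hd.
apply: DeriveDef; last by rewrite derive_pair.
by apply: diff_derivable; exact: differentiable_pair.
Qed.

(** The field of the variational equation: its second component is the linearization of F along the
    first. *)
Definition tangent (V : normedModType R) (F : V -> V) (p : V * V) : V * V :=
  (F p.1, 'D_p.2 F p.1).

Lemma smooth_tangent (V : normedModType R) (B : frame V) (F : V -> V) :
  smooth F -> smooth (tangent F).
Proof.
move=> sF k; apply: Ck_pair; first exact: openT.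
  by apply: (Ck_comp B B openT openT) (sF k) => //; exact: Ck_fst.
exact: (Ck_tangent B B).
Qed.

Lemma tangent_flow_line_fst (V : normedModType R) (F : V -> V) T d :
  flow_line (tangent F) T d -> flow_line F T (fst \o d).
Proof.
move=> [cd hd]; split=> [t|t tT].
  by apply: continuous_comp; [exact: cd|exact: lfst_cont].
exact: (is_derive_lin_comp (@lfst_cont R V V) (hd t tT)).
Qed.

(* The tangent field is linear along the fibres, so small initial vectors suffice. *)
Lemma tangent_flow_line_lin (V : normedModType R) (I : finType) (F : V -> V) T
    (c : R -> V) (q : I -> R -> V) (a : I -> R) :
  smooth F -> flow_line F T c ->
  (forall i, flow_line (tangent F) T (fun t => (c t, q i t))) ->
  flow_line (tangent F) T (fun t => (c t, \sum_i a i *: q i t)).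
Proof.
move=> sF [cc hc] hq.
split=> [t|t tT].
  apply: cvg_pair; first exact: cc.
  suff h : Ck_on 0 setT (fun t => \sum_i a i *: q i t) by exact: (h t Logic.I).
  apply: Ck_sum => [|i]; first exact: openT.
  move=> s _; apply: cvgZl_tmp.
  have [cqi _] := hq i.
  by apply: (@continuous_comp _ _ _ _ (lsnd V V) s (cqi s)); exact: lsnd_cont.
apply: is_derive_pair_curve; first exact: hc.
have dFc := smooth_differentiable (c t) sF.
rewrite (deriveE _ dFc) linear_sum; apply: is_derive_bigsum => i.
have [_ /(_ t tT) hqt] := hq i.
have := is_derive_lin_comp (@lsnd_cont R V V) hqt; rewrite /tangent /= => h.
by rewrite linearZ -(deriveE _ dFc); exact: (is_deriveZ (a i) h).
Qed.

End Dependence.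

Section SmoothDependence.
Context {R : realType}.

(** The field is clamped to a box one unit larger than the given line. Lines starting close enough
    stay in that box up to time 1, so they are lines of F itself. The common box rho provides
    uniform constants in [flow_Ck]. *)
Lemma flow_C0 (V : normedModType R) (B : frame V) (F : V -> V) c :
  Ck_on 1 setT F -> flow_line F 1 c ->
  exists (U : set V) (E : V -> V) (rho : R), [/\ open_nbhs (c 0) U, Ck_on 0 U E &
    forall x, U x -> exists d, [/\ flow_line F 1 d, d 0 = x, d 1 = E x &
      forall t : R, 0 <= t <= 1 -> box B rho (d t)]].
Proof.
move=> cF hc; have [r0 r00 hr0] := curve_bounded B hc.1.
pose r := r0 + 1; have rge0 : 0 <= r by rewrite addr_ge0.
have [L L0 [GL hex]] := clamped_field B cF rge0.
have [C C1 hC] := flow_line_dist (A := setT) L0 (fun x y _ _ => GL x y).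
have c01 t : 0 <= t <= 1 -> box B r0 (c t) by move=> t01; apply: hr0; lra.
have hcG : flow_line (F \o clamp B r) 1 c.
  apply: flow_line_eq hc => t t01 /=; rewrite clamp_id // => i.
  by apply: (le_trans (c01 t _ i)); [lra|rewrite lerDl].
have /choice[d hd] : forall x0, exists d, flow_line (F \o clamp B r) 2 d /\ d 0 = x0.
  by move=> x0; have [d hd d0] := hex x0; exists d.
have h12 : 1 <= 2 :> R by lra.
have hd1 x := flow_line_sub h12 (hd x).1.
have dist x y t : 0 <= t <= 1 -> fnorm B (d x t - d y t) <= C * fnorm B (x - y).
  move=> t01; have := hC 1 _ _ h12 (hd1 x) (hd1 y) (fun _ _ => I) (fun _ _ => I) t t01.
  by rewrite (hd x).2 (hd y).2.
have [K K0 hK] := fnorm_le_norm B.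
have C0 : 0 < C by exact: lt_le_trans ltr01 C1.
have CK0 : 0 < C * K by rewrite mulr_gt0.
(* For x in this ball C K |c 0 - x| < 1, the margin between r0 and r. *)
exists (ball (c 0) (C * K)^-1), (fun x => d x 1), r; split.
- by split; [exact: ball_open|apply: ballxx; rewrite invr_gt0].
- move=> x _; apply/cvgrPdist_lt => e e0.
  have [K' K'0 hK'] := norm_le_fnorm B.
  have e1 : 0 < e / (K' * (C * K)) by rewrite divr_gt0 // mulr_gt0.
  have : \forall y \near x, `|x - y| < e / (K' * (C * K)) by have := nbhsx_ballx x _ e1; rewrite -ball_normE.
  apply: filterS => y; rewrite ltr_pdivlMr ?mulr_gt0 // => hy.
  apply: (le_lt_trans (hK' _)); apply: le_lt_trans hy.
  have := dist x y 1; rewrite ler01 lexx => /(_ isT) h.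
  rewrite [leRHS]mulrC -!mulrA ler_wpM2l ?(ltW K'0) //; apply: (le_trans h).
  by rewrite ler_wpM2l ?(ltW C0).
- move=> x; rewrite -ball_normE /= => hx.
  have dbox t : 0 <= t <= 1 -> box B r (d x t).
    move=> t01 i; have -> : d x t = c t + (d x t - c t) by rewrite addrC subrK.
    rewrite linearD; apply: (le_trans (ler_normD _ _)); apply: lerD; first exact: c01.
    apply: (le_trans (le_fnorm i _)).
    have := hC 1 _ _ h12 (hd1 x) hcG (fun _ _ => I) (fun _ _ => I) t t01.
    rewrite (hd x).2 => h; apply: (le_trans h); rewrite fnormB.
    apply: (@le_trans _ _ (C * (K * `|c 0 - x|))).
      by rewrite ler_wpM2l ?(ltW C0).
    by rewrite mulrA -ler_pdivlMl // mulr1 ltW.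
  exists (d x); split=> //; first last.
    by rewrite (hd x).2.
  apply: flow_line_eq (hd1 x) => t t01 /=; rewrite clamp_id //; apply: dbox; lra.
Qed.

(* Induction on k: the derivative of the time-one map of F in the direction v is the fibre
   component of the time-one map of the tangent field of F, applied to small multiples of v;
   the latter is C^k by the induction hypothesis.  Smoothness in time comes for free by
   treating a scaling factor of the field as an extra coordinate. *)
Theorem flow_Ck k (V : normedModType R) (B : frame V) (F : V -> V) c :
  smooth F -> flow_line F 1 c ->
  exists (U : set V) (E : V -> V) (rho : R), [/\ open_nbhs (c 0) U, Ck_on k U E &
    forall x, U x -> exists d, [/\ flow_line F 1 d, d 0 = x, d 1 = E x &
      forall t : R, 0 <= t <= 1 -> box B rho (d t)]].
Proof.
elim: k V B F c => [|k IH] V B F c sF hc; first exact: flow_C0 (smooth_C1 sF) hc.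
have hT : flow_line (tangent F) 1 (fun t => (c t, 0)).
  split=> [t|t t01]; first by apply: cvg_pair; [exact: hc.1|exact: cvg_cst].
  by apply: is_derive_pair_curve; [exact: hc.2|rewrite derive0; exact: is_derive_cst].
have [U' [E' [rho [[oU' U'c] cE' hE']]]] :=
  IH _ (prod_frame B B) _ _ (smooth_tangent B sF) hT.
have [de /= de0 hde] : nbhs_ball (c 0, 0 : V) U'.
  by apply/nbhs_ballP; exact: open_nbhs_nbhs.
have hU x v : `|c 0 - x| < de -> `|v| < de -> U' (x, v).
  move=> hx hv; apply: hde; split; rewrite -ball_normE //=.
  by rewrite sub0r normrN.
(* The induction hypothesis provides E' only near (c 0, 0), so the basis vectors are shrunk by kap
   to have norm below de. *)
pose kap := de / (2 * (1 + \sum_i `|fvec B i|)).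
have sum0 : 0 <= \sum_i `|fvec B i| by exact: sumr_ge0.
have kap0 : 0 < kap by rewrite divr_gt0 // mulr_gt0 // ltr_pwDl.
have hkap i : `|kap *: fvec B i| < de.
  rewrite normrZ gtr0_norm // /kap mulrAC ltr_pdivrMr; last by rewrite mulr_gt0 // ltr_pwDl.
  rewrite ltr_pM2l //; have : `|fvec B i| <= \sum_i `|fvec B i|.
    by rewrite (bigD1 i) //= lerDl sumr_ge0.
  lra.
pose U := ball (c 0) de; pose E x := (E' (x, 0)).1.
have hUE x : U x -> `|c 0 - x| < de by rewrite /U -ball_normE.
have oU : open U by exact: ball_open.
(* The candidate derivative, linear in v by construction. Uniqueness for the tangent field shows
   that it is the fibre component of E' at small vectors. *)
pose l x (v : V) : V := \sum_i (fco B i v / kap) *: (E' (x, kap *: fvec B i)).2.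
have hl x h : U x -> `|h| < de -> E' (x, h) = (E x, l x h).
  move=> /hUE Ux hh; have [d [hd d0 d1 _]] := hE' _ (hU _ _ Ux hh).
  have h0 : `|0 : V| < de by rewrite normr0.
  have [e [he e0 e1 _]] := hE' _ (hU _ _ Ux h0).
  have hq (i : fidx B) : exists q, [/\ flow_line (tangent F) 1 q, q 0 = (x, kap *: fvec B i) &
      q 1 = E' (x, kap *: fvec B i)].
    by have [q [? ? ? _]] := hE' _ (hU _ _ Ux (hkap i)); exists q.
  have /choice[q {}hq] := hq.
  have h12 : 1 <= 2 :> R by lra.
  have fstE g : flow_line (tangent F) 1 g -> (g 0).1 = x -> forall t, 0 <= t <= 1 ->
      (g t).1 = (d t).1.
    move=> hg g0 t t01.
    have := flow_line_unique B (smooth_C1 sF) h12 (tangent_flow_line_fst hg)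
      (tangent_flow_line_fst hd).
    by rewrite /= g0 d0 => /(_ erefl t t01).
  have hqd i : flow_line (tangent F) 1 (fun t => ((fst \o d) t, (snd \o q i) t)).
    have [[cq dq] q0 _] := hq i; have hcd := tangent_flow_line_fst hd.
    split=> [t|t t01].
      apply: cvg_pair; first exact: hcd.1.
      exact: (@continuous_comp _ _ _ _ (lsnd V V) t (cq t) (@lsnd_cont R V V (q i t))).
    apply: is_derive_pair_curve; first exact: hcd.2.
    have := is_derive_lin_comp (@lsnd_cont R V V) (dq t t01).
    have t01' : 0 <= t <= 1 by lra.
    have [hqi _ _] := hq i.
    by rewrite /tangent /= (fstE _ hqi _ t t01') // q0.
  have hdl := tangent_flow_line_lin (fun i => fco B i h / kap) sF (tangent_flow_line_fst hd) hqd.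
  have dl0 : ((fst \o d) 0, \sum_i (fco B i h / kap) *: (snd \o q i) 0) = d 0.
    rewrite /= d0; congr pair; rewrite [RHS](frame_sum B); apply: eq_bigr => i _.
    by have [_ -> _] := hq i; rewrite /= scalerA divfK ?gt_eqF.
  have i01 : 0 <= (1 : R) <= 1 by rewrite ler01 lexx.
  have := flow_line_unique (prod_frame B B) (smooth_C1 (smooth_tangent B sF)) h12 hdl hd dl0 i01.
  rewrite /= -d1 => <-; congr pair.
    by rewrite -(fstE _ he _ 1 i01) ?e0 // e1.
  by apply: eq_bigr => i _; have [_ _ ->] := hq i.
have llin x : linear (l x).
  move=> a u v; rewrite /l scaler_sumr -big_split; apply: eq_bigr => i _.
  by rewrite linearP /= scalerA -scalerDl mulrDl mulrA.
pose L x : {linear V -> V} := HB.pack (l x) (GRing.isLinear.Build _ _ _ _ _ (llin x)).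
have Lc x : continuous (L x).
  suff h : Ck_on 0 setT (l x) by move=> v; exact: (h v I).
  apply: Ck_sum => [|i]; first exact: openT.
  have := Ck_lin_comp openT (@scalel_cont R V (kap^-1 *: (E' (x, kap *: fvec B i)).2))
    (@Ck_lin R V R 0 setT _ (fco_continuous B i)).
  by apply: Ck_eq; [exact: openT|move=> v _ /=; rewrite scalerA].
have dE x : U x -> differentiable E x /\ 'd E x = L x :> (V -> V).
  move=> Ux; apply: differentiable_eps => // e e0.
  have [Lp Lp0 hLp] := box_lipschitz B rho B (smooth_C1 sF).
  have [C C1 hC] := flow_line_dist Lp0 hLp.
  have [M M0 hM] := derive_fnorm_bound B rho sF.
  have [M2 M20 hM2] := taylor_bound B rho sF.
  have [C3 C31 hC3] := fnorm_gronwall B M0.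
  have [K K0 hK] := fnorm_le_norm B; have [K' K'0 hK'] := norm_le_fnorm B.
  pose G := K' * (C3 * (M2 * (C * K) ^+ 2)).
  have G0 : 0 <= G.
    have C30 : 0 <= C3 by exact: le_trans ler01 C31.
    by rewrite mulr_ge0 ?(ltW K'0) // mulr_ge0 // mulr_ge0 // sqr_ge0.
  have Uh : \forall h \near (0 : V), U (h + x).
    have : \forall y \near x, U y by exact: open_nbhs_nbhs.
    by rewrite (near_shift 0) /=; apply: filterS => h /=; rewrite subr0.
  (* The final error is G |h|^2; G + 1 covers the case G = 0. *)
  have eG : 0 < e / (G + 1) by rewrite divr_gt0 // ltr_wpDl.
  apply: filterS3 Uh (nbhs0_lt de0) (nbhs0_lt eG) => h Uhx hde' hG.
  have h0 : `|0 : V| < de by rewrite normr0.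
  have [zz [hz z0 z1 zb]] := hE' _ (hU _ _ (hUE _ Uhx) h0).
  have [d [hd d0 d1 db]] := hE' _ (hU _ _ (hUE _ Ux) hde').
  have hEl := hl x h Ux hde'.
  have hz' := tangent_flow_line_fst hz; have hp := tangent_flow_line_fst hd.
  have zb' (t : R) : 0 < t < 1 -> box B rho ((fst \o zz) t).
    by move=> t01 i; apply: (zb t _ (inl i)); lra.
  have db' (t : R) : 0 < t < 1 -> box B rho ((fst \o d) t).
    by move=> t01 i; apply: (db t _ (inl i)); lra.
  have h12 : 1 <= 2 :> R by lra.
  have dist t : 0 <= t <= 1 -> fnorm B ((zz t).1 - (d t).1) <= C * (K * `|h|).
    move=> t01; have := hC 1 _ _ h12 hz' hp zb' db' t t01.
    rewrite /= z0 d0 /= addrK => h1; apply: (le_trans h1).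
    by rewrite ler_wpM2l // (le_trans ler01).
  (* The error is z - p - q, with z the line from x + h, p the line from x and q the variation
     starting at h. It vanishes at time 0, and by Taylor's formula it satisfies the linear
     inequality with an inhomogeneity of order |h|^2. *)
  have := hC3 1 (fun t => (zz t).1 - (d t).1 - (d t).2)
    (fun t => F (zz t).1 - F (d t).1 - 'D_(d t).2 F (d t).1) (M2 * (C * (K * `|h|)) ^+ 2).
  rewrite z1 d1 z0 d0 /= addrK subrr fnorm0 add0r hEl /= -/(E (h + x)) => H.
  have {}H : fnorm B (E (h + x) - E x - l x h) <= C3 * (M2 * (C * (K * `|h|)) ^+ 2).
    apply: H.
    - by rewrite ler01.
    - by rewrite mulr_ge0 ?sqr_ge0.
    - have cd : continuous (snd \o d).
        move=> t; exact: (@continuous_comp _ _ _ _ (lsnd V V) t (hd.1 t) (@lsnd_cont R V V (d t))).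
      by move=> t; apply: cvgB (cd t); apply: cvgB; [exact: hz'.1|exact: hp.1].
    - move=> t t01; have := is_derive_lin_comp (@lsnd_cont R V V) (hd.2 t t01).
      by move=> hq; apply: is_deriveB hq; apply: is_deriveB; [exact: hz'.2|exact: hp.2].
    - move=> t t01; have t01' : 0 <= t <= 1 by lra.
      have dFd := smooth_differentiable (d t).1 sF.
      have -> : F (zz t).1 - F (d t).1 - 'D_(d t).2 F (d t).1 =
          (F (zz t).1 - F (d t).1 - 'D_((zz t).1 - (d t).1) F (d t).1) +
          'D_((zz t).1 - (d t).1 - (d t).2) F (d t).1.
        by rewrite !(deriveE _ dFd) (linearB ('d F ((d t).1)) ((zz t).1 - (d t).1)) addrA subrK.
      apply: (le_trans (fnormD _ _ _)); rewrite addrC; apply: lerD.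
        by apply: hM; exact: db'.
      apply: (le_trans (hM2 _ _ (zb' _ t01) (db' _ t01))); rewrite ler_wpM2l //.
      have h1 := dist t t01'.
      by apply: lerXn2r => //; rewrite nnegrE ?fnorm_ge0 //; exact: le_trans (fnorm_ge0 _ _) h1.
  apply: (le_trans (hK' _)); apply: (@le_trans _ _ (G * `|h| * `|h|)).
    by rewrite /G -!mulrA ler_wpM2l ?(ltW K'0) //; apply: (le_trans H); lra.
  rewrite ler_wpM2r //; move: hG; rewrite ltr_pdivlMr ?ltr_wpDl // mulrC => /ltW.
  by apply: le_trans; rewrite ler_wpM2r // lerDl.
exists U, E, rho; split.
- by split=> //; exact: ballxx.
- split=> [x Ux|v]; first by have [] := dE x Ux.
  have : Ck_on k U (fun x => l x v).
    apply: Ck_sum => // i.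
    have cpair : Ck_on k U (fun x : V => (x, kap *: fvec B i)).
      by apply: Ck_pair => //; [by apply: (@Ck_lin R V V k U idfun) => y; exact: cvg_id|exact: Ck_cst].
    have := @Ck_comp _ _ _ _ (prod_frame B B) (prod_frame B B) k U U' _ E' oU oU' _ cpair cE'.
    move=> /(_ (fun x Ux => hU _ _ (hUE _ Ux) (hkap i))) h1.
    have h2 := Ck_lin_comp oU (@lsnd_cont R V V) h1.
    apply: (Ck_coord (B := B)) => // j.
    have := Ck_mul oU (@Ck_cst R V R k U (fco B i v / kap)) (Ck_lin_comp oU (fco_continuous B j) h2).
    by apply: Ck_eq => // x Ux /=; rewrite linearZ.
  apply: Ck_eq => // x Ux; have [dEx EL] := dE x Ux.
  by rewrite (deriveE _ dEx) EL.
- move=> x /hUE Ux; have h0 : `|0 : V| < de by rewrite normr0.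
  have [d [hd d0 d1 db]] := hE' _ (hU _ _ Ux h0).
  exists (fst \o d); split=> //=; first exact: tangent_flow_line_fst.
  + by rewrite d0.
  + by rewrite d1.
  + by move=> t t01 i; exact: (db t t01 (inl i)).
Qed.

End SmoothDependence.

(** * The glued gradient field *)

Section Cutoff.
Context {R : realType}.

(* t^-k exp (-1/t), extended by 0: this family is closed under differentiation up to linear
   combinations, which gives smoothness of all its members at once. *)
Definition expinv (k : nat) (t : R) : R :=
  if 0 < t then expR (- t^-1) * t^-1 ^+ k else 0.

Lemma expinv_le0 k t : t <= 0 -> expinv k t = 0.
Proof. by move=> t0; rewrite /expinv ltNge t0. Qed.

Lemma expinv_gt0 k t : 0 < t -> 0 < expinv k t.
Proof. by move=> t0; rewrite /expinv t0 mulr_gt0 ?expR_gt0 // exprn_gt0 // invr_gt0. Qed.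

Lemma expinv_ge0 k t : 0 <= expinv k t.
Proof. by have [/expinv_le0->|/(expinv_gt0 k)/ltW] := leP t 0. Qed.

(** From exp x >= x^(k+2) / (k+2)! at x = 1/t. This quadratic decay makes the derivative at 0 exist
    and vanish. *)
Lemma expinv_bound k t : expinv k t <= k.+2`!%:R * t ^+ 2.
Proof.
have [t0|t0] := leP t 0; first by rewrite expinv_le0 // mulr_ge0 ?sqr_ge0.
rewrite /expinv t0.
have x0 : 0 <= t^-1 by rewrite invr_ge0 ltW.
have h := expR_ge1Dxn k.+1 x0.
have f0 : 0 < k.+2`!%:R :> R by rewrite ltr0n fact_gt0.
have {}h : t^-1 ^+ k.+2 <= k.+2`!%:R * expR t^-1.
  by rewrite mulrC -ler_pdivrMr //; apply: le_trans h; rewrite lerDr.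
rewrite expRN -ler_pdivlMl ?invr_gt0 ?expR_gt0 // invrK mulrA.
rewrite -ler_pdivrMr ?exprn_gt0 // -exprVn -exprD addn2 mulrC.
exact: h.
Qed.

Lemma is_derive_expinv k (t : R) :
  is_derive t 1 (expinv k) (expinv k.+2 t - k%:R * expinv k.+1 t).
Proof.
have [t0|t0|->] := ltgtP t 0.
- rewrite !expinv_le0 ?(ltW t0) // mulr0 subr0.
  apply: near_eq_is_derive (is_derive_cst (0 : R) t 1).
  have : nbhs t [set s : R | s < 0] by apply: open_nbhs_nbhs; split; [exact: open_lt|].
  by apply: filterS => s /= s0; rewrite expinv_le0 // ltW.
- have t0' : t != 0 by rewrite gt_eqF.
  have hi : is_derive t 1 (fun s : R => s^-1) (- t^-1 ^+ 2).
    have di : derivable (fun s : R => s^-1) t 1 by apply: derivableV.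
    apply: DeriveDef => //.
    by rewrite (@deriveV _ _ id) // derive_id /GRing.scale /= mulr1 exprVn.
  have hNi : is_derive t 1 (fun s : R => - s^-1) (t^-1 ^+ 2).
    by have := is_deriveN hi; rewrite opprK.
  have he := is_derive_real_comp hNi (is_derive_exp (- t^-1)).
  have hX : is_derive (t^-1 : R) 1 (fun s : R => s ^+ k) (k%:R * t^-1 ^+ k.-1).
    apply: DeriveDef; first exact: exprn_derivable.
    by rewrite exp_derive /GRing.scale /= mulr1.
  have hiX := is_derive_real_comp hi hX.
  have : is_derive t 1 (fun s : R => expR (- s^-1) * s^-1 ^+ k)
      (expinv k.+2 t - k%:R * expinv k.+1 t).
    apply: is_derive_eq (is_deriveM he hiX) _.
    rewrite /GRing.scale /= /expinv t0; case: (k) => [|j] /=; rewrite ?expr0 ?exprS; ring.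
  apply: near_eq_is_derive.
  have : nbhs t [set s : R | 0 < s] by apply: open_nbhs_nbhs; split; [exact: open_gt|].
  by apply: filterS => s /= s0; rewrite /expinv s0.
- rewrite !expinv_le0 // mulr0 subr0.
  have [|e e0|dh Dh] := @differentiable_eps R R R (expinv k) [the {linear R -> R} of \0] 0.
  + by move=> x; exact: cvg_cst.
  + have f0 : 0 < k.+2`!%:R :> R by rewrite ltr0n fact_gt0.
    apply: filterS (nbhs0_lt (divr_gt0 e0 f0)) => u.
    rewrite ltr_pdivlMr // mulrC => /ltW hu.
    rewrite addr0 (expinv_le0 k (lexx 0)) !subr0 ger0_norm ?expinv_ge0 //.
    apply: (le_trans (expinv_bound k u)).
    by rewrite -real_normK ?num_real // expr2 mulrA ler_wpM2r.
  + apply: DeriveDef; first exact: diff_derivable.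
    by rewrite deriveE // Dh.
Qed.

Lemma smooth_expinv k : smooth (expinv k).
Proof.
move=> j; elim: j k => [|j IH] k.
  move=> t _; apply/differentiable_continuous/derivable1_diffP.
  by have [] := is_derive_expinv k t.
have dk (t : R) : differentiable (expinv k) t.
  by apply/derivable1_diffP; have [] := is_derive_expinv k t.
split=> // v.
have cM l := Ck_mul openT (@Ck_cst R R R j setT v) (IH l).
have := Ck_add openT (cM k.+2) (Ck_mul openT (@Ck_cst R R R j setT (- k%:R)) (cM k.+1)).
apply: Ck_eq; first exact: openT.
move=> t _; rewrite (deriveE _ (dk t)) -[v in RHS]mulr1 -[v * 1]/(v *: 1) linearZ.
rewrite -(deriveE _ (dk t)); have [_ ->] := is_derive_expinv k t.
rewrite -[RHS]/(v * (expinv k.+2 t - k%:R * expinv k.+1 t)) /= -[1 *- k]/(- k%:R); ring.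
Qed.

End Cutoff.

(** * Euclidean gradients and the relative gradient *)

Section EuclideanGradient.
Context {R : realType} {n : nat}.
Implicit Types (f g : 'rV[R]_n -> R) (u v x : 'rV[R]_n).

Lemma dotC u v : dot u v = dot v u.
Proof. by apply: eq_bigr => i _; rewrite mulrC. Qed.

Lemma dotDl u v x : dot (u + v) x = dot u x + dot v x.
Proof. by rewrite /dot -big_split; apply: eq_bigr => i _; rewrite mxE mulrDl. Qed.

Lemma dotZl a u x : dot (a *: u) x = a * dot u x.
Proof. by rewrite /dot mulr_sumr; apply: eq_bigr => i _; rewrite mxE mulrA. Qed.

Lemma dotBl u v x : dot (u - v) x = dot u x - dot v x.
Proof. by rewrite dotDl -scaleN1r dotZl mulN1r. Qed.

Lemma dot0l x : dot 0 x = 0.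
Proof. by rewrite /dot big1 // => i _; rewrite mxE mul0r. Qed.

Lemma dot_ge0 u : 0 <= dot u u.
Proof. by apply: sumr_ge0 => i _; rewrite -expr2 sqr_ge0. Qed.

Lemma dot_gt0 u : (0 < dot u u) = (u != 0).
Proof.
rewrite lt_neqAle dot_ge0 andbT eq_sym; congr (~~ _).
apply/eqP/eqP => [h|->]; last exact: dot0l.
apply/rowP => i; rewrite mxE; apply/eqP; rewrite -sqrf_eq0 expr2; apply/eqP.
by apply: (psumr_eq0P _ h) => // j _; rewrite -expr2 sqr_ge0.
Qed.

Lemma sqr_enorm u : enorm u ^+ 2 = dot u u.
Proof. by rewrite sqr_sqrtr // dot_ge0. Qed.

Lemma enorm_ge0 u : 0 <= enorm u.
Proof. exact: sqrtr_ge0. Qed.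

Lemma enorm_gt0 u : (0 < enorm u) = (u != 0).
Proof. by rewrite sqrtr_gt0 dot_gt0. Qed.

Lemma enorm_le u (r : R) : 0 <= r -> (enorm u <= r) = (dot u u <= r ^+ 2).
Proof. by move=> r0; rewrite -sqr_enorm ler_pXn2r ?nnegrE ?enorm_ge0. Qed.

Lemma dot_le u v : `|dot u v| <= enorm u * enorm v.
Proof.
have [->|v0] := eqVneq v 0; first by rewrite dotC dot0l normr0 mulr_ge0 ?enorm_ge0.
have vv : 0 < dot v v by rewrite dot_gt0.
rewrite -(@ler_pXn2r _ 2) ?nnegrE ?mulr_ge0 ?enorm_ge0 // exprMn !sqr_enorm.
rewrite real_normK ?num_real //.
have := dot_ge0 (dot v v *: u - dot u v *: v).
rewrite !(dotBl, dotZl, dotC _ (_ - _)) (dotC v u).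
have -> : dot v v * (dot v v * dot u u - dot u v * dot u v) -
  dot u v * (dot v v * dot u v - dot u v * dot v v) =
  dot v v * (dot u u * dot v v - dot u v ^+ 2) by ring.
by rewrite pmulr_rge0 // subr_ge0.
Qed.

Lemma co_le_dot (i : 'I_n) u : u 0 i ^+ 2 <= dot u u.
Proof.
rewrite /dot (bigD1 i) //= expr2 lerDl; apply: sumr_ge0 => j _.
by rewrite -expr2 sqr_ge0.
Qed.

Lemma Ck_dot (V : normedModType R) k (O : set V) (F G : V -> 'rV[R]_n) : open O ->
  Ck_on k O F -> Ck_on k O G -> Ck_on k O (fun y => dot (F y) (G y)).
Proof.
move=> oO cF cG; apply: Ck_sum => // i.
by apply: Ck_mul => //; exact: (Ck_lin_comp oO (fco_continuous (row_frame n) i)).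
Qed.

Lemma Ck_grad k f : smooth f -> Ck_on k setT (grad f).
Proof.
move=> sf; apply: (Ck_coord (B := row_frame n)) => [|i]; first exact: openT.
have [_ /(_ (delta_mx 0 i))] := sf k.+1.
by apply: Ck_eq; [exact: openT|move=> x _; rewrite /= mxE].
Qed.

Lemma derive_grad f x v : differentiable f x -> 'D_v f x = dot v (grad f x).
Proof.
by move=> df; rewrite (derive_frame (row_frame n)) //; apply: eq_bigr => i _; rewrite mxE.
Qed.

Lemma is_derive_along f (c : R -> 'rV[R]_n) (t : R) d : smooth f ->
  is_derive t 1 c d -> is_derive t 1 (f \o c) (dot d (grad f (c t))).
Proof.
move=> sf hc; have df := smooth_differentiable (c t) sf.
by rewrite -derive_grad //; exact: is_derive_curve.
Qed.

(* True also where grad g vanishes, since the quotient is then 0 / 0 = 0. *)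
Lemma rel_grad_orthogonal g f x : dot (rel_grad g f x) (grad g x) = 0.
Proof.
rewrite /rel_grad dotBl dotZl sqr_enorm.
have [->|g0] := eqVneq (grad g x) 0; first by rewrite dotC !dot0l mulr0 subrr.
by rewrite divfK ?subrr // gt_eqF // dot_gt0.
Qed.

(** [rel_grad] differs from grad f by a multiple of grad g, to which it is orthogonal. So f
    increases along it at the rate of its squared norm. *)
Lemma dot_rel_grad g f x : dot (rel_grad g f x) (grad f x) = dot (rel_grad g f x) (rel_grad g f x).
Proof.
set w := rel_grad g f x; have := rel_grad_orthogonal g f x; rewrite -/w => wg.
have -> : dot w w = dot (grad f x) w -
    dot (grad f x) (grad g x) / enorm (grad g x) ^+ 2 * dot (grad g x) w.
  by rewrite {1}/w /rel_grad dotBl dotZl.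
by rewrite (dotC (grad g x) w) wg mulr0 subr0 dotC.
Qed.

Lemma Ck_scale (V : normedModType R) k (O : set V) (a : V -> R) (F : V -> 'rV[R]_n) : open O ->
  Ck_on k O a -> Ck_on k O F -> Ck_on k O (fun y => a y *: F y).
Proof.
move=> oO ca cF; apply: (Ck_coord (B := row_frame n)) => // i.
have := Ck_mul oO ca (Ck_lin_comp oO (fco_continuous (row_frame n) i) cF).
by apply: Ck_eq => // x _; rewrite /= mxE.
Qed.

Lemma Ck_rel_grad k g f : smooth f -> smooth g ->
  Ck_on k [set x | grad g x != 0] (rel_grad g f).
Proof.
move=> sf sg; set O := [set x | _].
have cg := Ck_grad k sg; have cf := Ck_grad k sf.
have oO : open O.
  have -> : O = (fun x => dot (grad g x) (grad g x)) @^-1` [set s : R | 0 < s].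
    by apply/seteqP; split=> x; rewrite /O /= dot_gt0.
  apply: open_comp; last exact: open_gt.
  by move=> x _; exact: (Ck_continuous (Ck_dot openT cg cg) (I : setT x)).
have sub : O `<=` setT by [].
have {}cg := Ck_sub sub cg; have {}cf := Ck_sub sub cf.
have cgg := Ck_dot oO cg cg.
have ci : Ck_on k O (fun x => (dot (grad g x) (grad g x))^-1).
  by apply: Ck_inv => // x; rewrite /O /= -dot_gt0 => /gt_eqF ->.
have := Ck_add oO cf (Ck_scale oO (Ck_mul oO (Ck_mul oO (Ck_dot oO cf cg) ci)
  (@Ck_cst _ _ R k O (-1 : R))) cg).
by apply: Ck_eq => // x _; rewrite /rel_grad sqr_enorm /= mulrN1 scaleNr.
Qed.

End EuclideanGradient.

(** * The cutoffs and the field w *)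

Section GluedField.
Context {R : realType} {n : nat}.
Implicit Types (x : 'rV[R]_n).

Section Definitions.
Context (f g : 'rV[R]_n -> R) (lam r eps : R).

(** Positive for |x|^2 < 2 (r + 1)^2, whereas [outer_weight] is positive for |x|^2 > (r + 1)^2: the
    two regions overlap and cover the space. [outer_weight] vanishes for |x| <= r + 1, well around
    the ball where the Malgrange condition says nothing about [rel_grad]. *)
Definition inner_weight x : R := expinv 0 (2 * (r + 1) ^+ 2 - dot x x).

Definition outer_weight x : R := expinv 0 (dot x x - (r + 1) ^+ 2).

Definition level_weight x : R := expinv 0 ((eps / 2) ^+ 2 - (f x - lam) ^+ 2).

Definition far_weight x : R := expinv 0 ((f x - lam) ^+ 2 - (eps / 4) ^+ 2).

Definition raw_field x : 'rV[R]_n :=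
  inner_weight x *: grad f x + outer_weight x *: rel_grad g f x.

Definition field_den x : R :=
  level_weight x * dot (raw_field x) (grad f x) + far_weight x.

(* Both weights of [field_den] are needed: the field vanishes for |f - lam| >= eps / 2, hence is
   smooth although [raw_field] is not controlled there, and it satisfies <w, grad f> = 1 for
   |f - lam| <= eps / 4, where [far_weight] vanishes. *)
Definition glued_field x : 'rV[R]_n := (level_weight x / field_den x) *: raw_field x.

End Definitions.

Context (f g : 'rV[R]_n -> R) (S U : set R) (lam r eps : R).
Context (sf : smooth f) (sg : smooth g) (r0 : 0 < r) (eps0 : 0 < eps).
Context (level_U : forall x, `|f x - lam| < eps -> U (f x)).
Context (inner_noncritical : forall x, `|f x - lam| < eps -> enorm x <= r -> grad f x != 0).
Context (tube_grad : forall x, outer_tube f U r x -> grad g x != 0).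
Context (tube_S : outer_tube f U r `<=` g @^-1` S).
Context (tube_delta : forall s, S s -> exists2 delta : R, 0 < delta &
  forall x, (outer_tube f U r `&` g @^-1` [set s]) x -> delta <= enorm (rel_grad g f x) * enorm x).

Local Notation a := (inner_weight r).
Local Notation b := (outer_weight r).
Local Notation beta := (level_weight f lam eps).
Local Notation kappa := (far_weight f lam eps).
Local Notation W := (raw_field f g r).
Local Notation den := (field_den f g lam r eps).
Local Notation w := (glued_field f g lam r eps).

(** The tube lies over S, so the bound for s = g x applies at x, and its delta > 0 excludes a
    zero. *)
Lemma tube_rel_grad x : outer_tube f U r x -> rel_grad g f x != 0.
Proof.
move=> Dx; have [delta d0 /(_ x (conj Dx erefl))] := tube_delta (tube_S Dx).
by move=> h; rewrite -enorm_gt0; have := enorm_ge0 x; have := enorm_ge0 (rel_grad g f x); nra.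
Qed.

Lemma in_tube x : `|f x - lam| < eps -> r < enorm x -> outer_tube f U r x.
Proof. by move=> /level_U Ux rx; split => //=; apply/negP; rewrite -ltNge. Qed.

Lemma raw_dot x : dot (W x) (grad f x) =
  a x * dot (grad f x) (grad f x) + b x * dot (rel_grad g f x) (rel_grad g f x).
Proof. by rewrite /raw_field dotDl !dotZl dot_rel_grad. Qed.

Lemma raw_dot_ge0 x : 0 <= dot (W x) (grad f x).
Proof. by rewrite raw_dot addr_ge0 // mulr_ge0 ?expinv_ge0 ?dot_ge0. Qed.

Lemma far_norm x : (r + 1) ^+ 2 < dot x x -> r < enorm x.
Proof.
rewrite ltNge; move=> h; rewrite ltNge; apply: contra h => h.
have r1 : 0 <= r + 1 by rewrite addr_ge0 // ltW.
by rewrite -sqr_enorm lerXn2r ?nnegrE ?enorm_ge0 // (le_trans h) // lerDl.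
Qed.

Lemma raw_dot_gt0 x : `|f x - lam| < eps -> 0 < dot (W x) (grad f x).
Proof.
move=> fx; rewrite raw_dot; have [xr|xr] := leP (enorm x) r.
  have ax : 0 < a x.
    apply: expinv_gt0; rewrite -sqr_enorm subr_gt0.
    have : enorm x ^+ 2 <= r ^+ 2 by rewrite lerXn2r ?nnegrE ?enorm_ge0 // ltW.
    by rewrite sqrrD; have := sqr_ge0 r; move: r0; lra.
  rewrite ltr_pwDl //; last by rewrite mulr_ge0 ?expinv_ge0 ?dot_ge0.
  by rewrite mulr_gt0 // dot_gt0 inner_noncritical.
have rg := tube_rel_grad (in_tube fx xr).
(* Outside the ball grad f cannot vanish either, since its product with [rel_grad] is positive; so
   the inner term is positive as long as its weight is. *)
have fg : grad f x != 0.
  by apply: contraNneq rg => f0; rewrite -[_ == 0]negbK -dot_gt0 -dot_rel_grad f0 dotC dot0l ltxx.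
have [h|h] := ltP (dot x x) (2 * (r + 1) ^+ 2).
  rewrite ltr_pwDl //; last by rewrite mulr_ge0 ?expinv_ge0 ?dot_ge0.
  by rewrite mulr_gt0 ?dot_gt0 // expinv_gt0 // subr_gt0.
rewrite ltr_wpDl //; first by rewrite mulr_ge0 ?expinv_ge0 ?dot_ge0.
rewrite mulr_gt0 ?dot_gt0 // expinv_gt0 // subr_gt0 (lt_le_trans _ h) //.
have : 0 < (r + 1) ^+ 2 by rewrite exprn_gt0 //; move: r0; lra.
lra.
Qed.

Lemma level_weight_gt0 x : (0 < beta x) = (`|f x - lam| < eps / 2).
Proof.
have e2 : 0 <= eps / 2 by rewrite divr_ge0 // ltW.
have -> : (`|f x - lam| < eps / 2) = ((f x - lam) ^+ 2 < (eps / 2) ^+ 2).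
  by rewrite -(real_normK (num_real (f x - lam))) ltr_pXn2r ?nnegrE.
apply/idP/idP => h; last by apply: expinv_gt0; rewrite subr_gt0.
rewrite ltNge; apply/negP => t0; move: h.
by rewrite /level_weight expinv_le0 ?ltxx // subr_le0.
Qed.

Lemma far_weight_eq0 x : `|f x - lam| <= eps / 4 -> kappa x = 0.
Proof.
move=> h; apply: expinv_le0; rewrite subr_le0 -(real_normK (num_real (f x - lam))).
by rewrite lerXn2r ?nnegrE //; move: r0 eps0; lra.
Qed.

Lemma far_weight_gt0 x : eps / 4 < `|f x - lam| -> 0 < kappa x.
Proof.
move=> h; apply: expinv_gt0; rewrite subr_gt0 -(real_normK (num_real (f x - lam))).
by rewrite ltrXn2r //; move: r0 eps0; lra.
Qed.

(** The first summand is positive within eps / 4 of the level lam, the second one beyond. *)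
Lemma den_gt0 x : 0 < den x.
Proof.
have [h|h] := leP (`|f x - lam|) (eps / 4); last first.
  rewrite ltr_wpDl ?far_weight_gt0 //.
  by rewrite mulr_ge0 ?expinv_ge0 ?raw_dot_ge0.
rewrite ltr_pwDl ?expinv_ge0 // mulr_gt0 //; first by rewrite level_weight_gt0; move: r0 eps0; lra.
by apply: raw_dot_gt0; move: r0 eps0; lra.
Qed.

Lemma glued_dot x : dot (w x) (grad f x) = beta x * dot (W x) (grad f x) / den x.
Proof. by rewrite /glued_field dotZl mulrAC. Qed.

(** These bounds hold on the whole space; they keep a line of s w in the band of levels in
    [flow_level]. *)
Lemma glued_dot_itv x : 0 <= dot (w x) (grad f x) <= 1.
Proof.
have h : 0 <= beta x * dot (W x) (grad f x) by rewrite mulr_ge0 ?expinv_ge0 ?raw_dot_ge0.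
rewrite glued_dot divr_ge0 ?(ltW (den_gt0 x)) //= ler_pdivrMr ?den_gt0 // mul1r.
by rewrite lerDl expinv_ge0.
Qed.

Lemma glued_dot_eq1 x : `|f x - lam| <= eps / 4 -> dot (w x) (grad f x) = 1.
Proof.
move=> h; rewrite glued_dot; have := gt_eqF (den_gt0 x).
by rewrite /field_den far_weight_eq0 // addr0 => /negbT d0; rewrite divff.
Qed.

Lemma glued_outer x : 2 * (r + 1) ^+ 2 <= dot x x ->
  w x = (beta x * b x / den x) *: rel_grad g f x.
Proof.
move=> h; rewrite /glued_field /raw_field.
have -> : a x = 0 by apply: expinv_le0; rewrite subr_le0.
by rewrite scale0r add0r scalerA mulrAC.
Qed.

Lemma glued_orthogonal x : 2 * (r + 1) ^+ 2 <= dot x x -> dot (w x) (grad g x) = 0.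
Proof. by move=> h; rewrite glued_outer // dotZl rel_grad_orthogonal mulr0. Qed.

(** Far out w = mu grad_g f with mu |grad_g f|^2 <= 1. Multiplying |<w, x>| <= mu |grad_g f| |x| by
    delta <= |grad_g f| |x| gives M = 1 / delta, which depends on s as delta does. Where the tube is
    left, w = 0. *)
Lemma glued_growth s : exists2 M : R, 0 <= M &
  forall x, g x = s -> 2 * (r + 1) ^+ 2 <= dot x x -> `|dot (w x) x| <= M * dot x x.
Proof.
have key x : 2 * (r + 1) ^+ 2 <= dot x x -> w x = 0 \/ outer_tube f U r x.
  move=> h; have [b0|b0] := ltP 0 (beta x).
    right; apply: in_tube; first by move: b0; rewrite level_weight_gt0; move: r0 eps0; lra.
    apply: far_norm; apply: lt_le_trans h.
    have : 0 < (r + 1) ^+ 2 by rewrite exprn_gt0 //; move: r0; lra.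
    move: r0 eps0; lra.
  left; have : beta x = 0 by apply/eqP; rewrite eq_le b0 expinv_ge0.
  by rewrite /glued_field => ->; rewrite mul0r scale0r.
(* A level outside S does not meet the tube, so w vanishes on its far part. *)
have [Ss|nS] := pselect (S s); last first.
  exists 0 => // x gx /key [->|/tube_S]; first by rewrite dot0l normr0 mul0r.
  by rewrite /= gx.
have [delta d0 hd] := tube_delta Ss; exists delta^-1; first by rewrite invr_ge0 ltW.
move=> x gx h; have [->|Dx] := key x h.
  by rewrite dot0l normr0 mulr_ge0 ?dot_ge0 // invr_ge0 ltW.
have {}hd := hd x (conj Dx gx); rewrite glued_outer // dotZl normrM.
set mu := _ / _; set rg := rel_grad g f x in hd *.
have mu0 : 0 <= mu by rewrite /mu !mulr_ge0 ?expinv_ge0 // invr_ge0 ltW // den_gt0.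
(* The numerator is one of the nonnegative summands of [den]. *)
have mu1 : mu * dot rg rg <= 1.
  rewrite /mu mulrAC ler_pdivrMr ?den_gt0 // mul1r /field_den raw_dot -/rg.
  have := expinv_ge0 0 ((f x - lam) ^+ 2 - (eps / 4) ^+ 2); rewrite -/(kappa x).
  have : 0 <= beta x * (a x * dot (grad f x) (grad f x)).
    by rewrite !mulr_ge0 ?expinv_ge0 ?dot_ge0.
  move: r0 eps0; lra.
rewrite ger0_norm // [leRHS]mulrC ler_pdivlMr // -mulrA.
apply: (@le_trans _ _ (mu * ((enorm rg * enorm x) * (enorm rg * enorm x)))).
  rewrite ler_wpM2l //; apply: ler_pM => //; [exact: ltW|exact: dot_le].
have -> : mu * ((enorm rg * enorm x) * (enorm rg * enorm x)) =
  (mu * enorm rg ^+ 2) * enorm x ^+ 2 by ring.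
by rewrite !sqr_enorm -[leRHS]mul1r ler_wpM2r // dot_ge0.
Qed.

Lemma open_gt_fun (h : 'rV[R]_n -> R) (c : R) : Ck_on 0 setT h -> open [set x | c < h x].
Proof.
move=> ch; have -> : [set x | c < h x] = h @^-1` [set s | c < s] by [].
by apply: open_comp; [move=> x _; exact: ch|exact: open_gt].
Qed.

Lemma Ck_expinv k (h : 'rV[R]_n -> R) : Ck_on k setT h -> Ck_on k setT (fun x => expinv 0 (h x)).
Proof.
move=> ch; exact: (Ck_comp_real real_frame openT (fun _ _ => I) ch (smooth_expinv 0 k)).
Qed.

Lemma smooth_glued_field : smooth w.
Proof.
move=> k.
have c_cst j (c : R) : Ck_on j setT (fun _ : 'rV[R]_n => c) by exact: Ck_cst.
have c_opp j (h : 'rV[R]_n -> R) : Ck_on j setT h -> Ck_on j setT (fun x => - h x).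
  move=> ch; apply: Ck_eq (Ck_mul openT (c_cst j (-1)) ch); first exact: openT.
  by move=> x _; rewrite mulN1r.
have c_id j : Ck_on j setT (fun x : 'rV[R]_n => x).
  by apply: (@Ck_lin R _ _ j setT idfun) => x; exact: cvg_id.
have c_dot j : Ck_on j setT (fun x => dot x x) := Ck_dot openT (c_id j) (c_id j).
have c_f j : Ck_on j setT (fun x => f x - lam) by apply: Ck_add; [exact: openT|exact: sf|].
have c_f2 j : Ck_on j setT (fun x => (f x - lam) ^+ 2) := Ck_mul openT (c_f j) (c_f j).
have c_a : Ck_on k setT a by apply: Ck_expinv; apply: Ck_add; [exact: openT| |exact: c_opp].
have c_b : Ck_on k setT b by apply: Ck_expinv; apply: Ck_add; [exact: openT| |].
have c_beta : Ck_on k setT beta.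
  by apply: Ck_expinv; apply: Ck_add; [exact: openT| |exact: c_opp].
have c_kappa : Ck_on k setT kappa by apply: Ck_expinv; apply: Ck_add; [exact: openT| |].
(* V1 is |f - lam| < eps, where [den] is smooth; V2 is |f - lam| > eps / 2, where w = 0. Together
   they cover the space. Below, V1 is covered in turn by A1, outside the ball, where grad g is
   nonzero, and A2, where [outer_weight] vanishes. *)
pose V1 := [set x | - eps ^+ 2 < - (f x - lam) ^+ 2].
pose V2 := [set x | (eps / 2) ^+ 2 < (f x - lam) ^+ 2].
have oV1 : open V1 by apply: open_gt_fun; exact: c_opp.
have oV2 : open V2 by exact: open_gt_fun.
have V1f x : V1 x -> `|f x - lam| < eps.
  rewrite /V1 /= ltrN2 -(real_normK (num_real (f x - lam))) ltr_pXn2r ?nnegrE //.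
  exact: ltW.
pose A1 := V1 `&` [set x | r ^+ 2 < dot x x].
pose A2 := V1 `&` [set x | - (r + 1) ^+ 2 < - dot x x].
have oA1 : open A1 by apply: openI => //; exact: open_gt_fun.
have oA2 : open A2 by apply: openI => //; apply: open_gt_fun; exact: c_opp.
have c_rg : Ck_on k V1 (fun x => b x *: rel_grad g f x).
  apply: Ck_local => x Vx.
  have [h|h] := ltP (r ^+ 2) (dot x x).
    exists A1; first by split.
    apply: Ck_scale => //; first exact: Ck_sub c_b.
    apply: Ck_sub (Ck_rel_grad k sf sg) => y [/V1f fy ry] /=.
    apply: tube_grad; apply: in_tube => //.
    by move: ry => /=; rewrite -sqr_enorm ltr_pXn2r ?nnegrE ?enorm_ge0 // ltW.
  exists A2.
    split=> //=; rewrite ltrN2; apply: (le_lt_trans h).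
    by rewrite ltrXn2r ?ltW //; move: r0; lra.
  apply: Ck_eq (Ck_cst k A2 (0 : 'rV[R]_n)) => // y [_ /=]; rewrite ltrN2 => hy.
  have -> : b y = 0 by apply: expinv_le0; rewrite subr_le0 ltW.
  by rewrite scale0r.
have sub (O : set 'rV[R]_n) : O `<=` setT by [].
have c_grad := Ck_sub (@sub V1) (Ck_grad k sf).
have c_W : Ck_on k V1 W.
  by apply: Ck_add => //; apply: Ck_scale => //; exact: Ck_sub c_a.
have c_den : Ck_on k V1 den.
  apply: Ck_add => //; last exact: Ck_sub c_kappa.
  by apply: Ck_mul => //; [exact: Ck_sub c_beta|exact: Ck_dot].
apply: Ck_local => x _.
have [h|h] := ltP ((eps / 2) ^+ 2) ((f x - lam) ^+ 2).
  exists V2 => //; apply: Ck_eq (Ck_cst k V2 (0 : 'rV[R]_n)) => // y hy.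
  rewrite /glued_field; have -> : beta y = 0 by apply: expinv_le0; rewrite subr_le0 ltW.
  by rewrite mul0r scale0r.
exists V1.
  rewrite /V1 /= ltrN2; apply: (le_lt_trans h).
  by rewrite ltrXn2r //; move: eps0; lra.
apply: Ck_scale => //; apply: Ck_mul => //; first exact: Ck_sub c_beta.
by apply: Ck_inv => // y _; rewrite gt_eqF // den_gt0.
Qed.

End GluedField.

(** * Completeness and the trivialization *)

Section Completeness.
Context {R : realType} {n : nat}.
Implicit Types (x : 'rV[R]_n) (c : R -> 'rV[R]_n).

Lemma is_derive_dot c (t : R) d : is_derive t 1 c d ->
  is_derive t 1 (fun s => dot (c s) (c s)) (2 * dot d (c t)).
Proof.
move=> hc; rewrite {2}/dot mulr_sumr; apply: is_derive_bigsum => i.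
have hi := is_derive_co (B := row_frame n) i hc.
apply: is_derive_eq (is_deriveM hi hi) _.
by rewrite /GRing.scale /=; ring.
Qed.

Lemma continuous_dot c : continuous c -> continuous (fun s => dot (c s) (c s)).
Proof.
move=> cc; have ck : Ck_on 0 setT c by move=> s _; exact: cc.
by move=> s; exact: (Ck_continuous (Ck_dot openT ck ck) (I : setT s)).
Qed.

(** The derivative bound is known only below d. Up to the first time when y reaches d it gives y <=
    y s + M (t - s) < d, so that time does not exist. *)
Lemma barrier (y dy : R -> R) (s t M d : R) : s <= t -> 0 <= M -> continuous y ->
  (forall u, s < u < t -> is_derive u 1 y (dy u)) ->
  (forall u, s < u < t -> y u < d -> dy u <= M) ->
  y s + M * (t - s) < d -> y t < d.
Proof.
move=> st M0 cy hy Hy ysd; rewrite ltNge; apply/negP => ytd.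
pose Z := [set u | s <= u <= t /\ d <= y u].
have Zt : Z t by split; rewrite ?st ?lexx.
have hZ : has_inf Z by split; [exists t|exists s => u [/andP[]]].
pose u := inf Z.
have su : s <= u by apply: lb_le_inf => [|v [/andP[]]] //; exists t.
have ut : u <= t by apply: ge_inf => //; case: hZ.
have below v : s <= v < u -> y v < d.
  move=> /andP[sv vu]; rewrite ltNge; apply/negP => dv.
  have : u <= v by apply: ge_inf; [case: hZ|split=> //; rewrite sv (le_trans (ltW vu))].
  by rewrite leNgt vu.
have yu : d <= y u.
  rewrite leNgt; apply/negP => yud.
  have dy0 : 0 < d - y u by rewrite subr_gt0.
  have /cvgrPdist_lt /(_ _ dy0) /nbhs_ballP[e /= e0 he] := cy u.
  have [v [/andP[sv vt] dv] vu] := inf_adherent e0 hZ.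
  have uv : u <= v by apply: ge_inf; [case: hZ|split=> //; rewrite sv].
  have := he v; rewrite /ball /= ler0_norm ?subr_le0 // opprB ltrBlDl => /(_ vu).
  rewrite ltr_norml => /andP[h _]; move: h dv; lra.
have cM : {within `[s, u], continuous (fun v : R => M * v)}.
  by apply: within_cont => v; exact: mulrl_continuous.
have hM v : s < v < u -> is_derive v 1 (fun w => M * w) M.
  by move=> _; apply: is_derive_eq; rewrite /GRing.scale /= mulr1.
have hyu v : s < v < u -> is_derive v 1 y (dy v).
  by move=> /andP[sv vu]; apply: hy; rewrite sv (lt_le_trans vu).
have := increment_le su (within_cont cy) cM hyu hM.
have H v : s < v < u -> dy v <= M.
  move=> /andP[sv vu]; apply: Hy; first by rewrite sv (lt_le_trans vu).
  by apply: below; rewrite (ltW sv).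
move=> /(_ H) h; have : M * (u - s) <= M * (t - s) by rewrite ler_wpM2l // lerB.
by move: h yu ysd; lra.
Qed.

Lemma box_of_dot (K : R) x : dot x x <= K -> box (row_frame n) (K + 1) x.
Proof.
move=> h i; have : x 0 i ^+ 2 <= K by exact: le_trans (co_le_dot i x) h.
rewrite -(real_normK (num_real (x 0 i))) => h2; change (`|x 0 i| <= K + 1).
have := sqr_ge0 (`|x 0 i| - 1); nra.
Qed.

Lemma curve_dot_bounded c : continuous c ->
  exists2 K, 0 <= K & forall t : R, 0 <= t <= 1 -> dot (c t) (c t) <= K.
Proof.
move=> /continuous_dot cd.
have [K K0 hK] := bounded_on_compact (@segment_compact R 0 1) cd.
exists K => // t t01; apply: (le_trans (ler_norm _)); apply: hK.
by rewrite /= in_itv.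
Qed.

(* Either the curve finally stays outside the ball, where g is constant along it and the growth
   bound for that single value of g applies up to the final time; or it returns to the ball at
   times arbitrarily close to the final time, and then it cannot go far in the time that is left. *)
Lemma flow_complete (g : 'rV[R]_n -> R) (v : 'rV[R]_n -> 'rV[R]_n) (rho0 : R) x :
  smooth v -> smooth g ->
  (forall z, rho0 <= dot z z -> dot (v z) (grad g z) = 0) ->
  (forall s, exists2 M, 0 <= M &
     forall z, g z = s -> rho0 <= dot z z -> `|dot (v z) z| <= M * dot z z) ->
  exists2 c, flow_line v 1 c & c 0 = x.
Proof.
move=> sv sg orth growth; have cv := smooth_C1 sv.
apply: (@flow_line_continuation R _ (row_frame n) v x cv) => tau /andP[tau0 tau1] ex_T.
have t2 T : T < tau -> T <= 2 by move=> ?; lra.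
have uniq T c T' c' : 0 <= T -> T <= T' -> T' < tau -> flow_line v T c -> c 0 = x ->
    flow_line v T' c' -> c' 0 = x -> c T = c' T.
  move=> T0 TT' T't hc c0 hc' c'0.
  apply: (flow_line_unique (row_frame n) cv _ hc (flow_line_sub TT' hc')).
  - by apply: t2; exact: le_lt_trans T't.
  - by rewrite c0.
  - by rewrite T0 lexx.
suff [K hK] : exists K, forall T c, 0 <= T < tau -> flow_line v T c -> c 0 = x ->
    dot (c T) (c T) <= K.
  by exists (K + 1) => T c hT hc c0; apply: box_of_dot; exact: hK hc c0.
have [[t1 /andP[t10 t1tau] far]|near_] := pselect (exists2 t1, 0 <= t1 < tau & forall T c,
    t1 <= T < tau -> flow_line v T c -> c 0 = x -> rho0 <= dot (c T) (c T)).
  have [c1 hc1 c10] : exists2 c, flow_line v t1 c & c 0 = x by apply: ex_T; rewrite t10.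
  have [K1 K10 hK1] := curve_dot_bounded hc1.1.
  (* After t1 no other level of g is met, so the constant of this one level suffices. *)
  have [M M0 hM] := growth (g (c1 t1)).
  exists (K1 + expR (2 * M) * K1) => T c /andP[T0 Ttau] hc c0.
  have [Tt1|t1T] := leP T t1.
    rewrite (uniq T c t1 c1) //; apply: ler_wpDr; first by rewrite mulr_ge0 ?expR_ge0.
    by apply: hK1; rewrite T0 /=; lra.
  have t1E : c1 t1 = c t1 by apply: (uniq t1 c1 T c) => //; exact: ltW.
  have farc s : t1 <= s <= T -> rho0 <= dot (c s) (c s).
    move=> /andP[t1s sT]; apply: far => //; first by rewrite t1s (le_lt_trans sT).
    exact: flow_line_sub sT hc.
  have in0 s : t1 < s < T -> 0 < s < T by move=> /andP[h ->]; rewrite (le_lt_trans t10).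
  have gc s : t1 <= s <= T -> g (c s) = g (c1 t1).
    move=> /andP[t1s sT]; rewrite t1E.
    have cg : continuous (g \o c).
      move=> u; apply: continuous_comp; first exact: hc.1.
      exact: (Ck_continuous (sg 0) (I : setT (c u))).
    have := @increment_bound _ (g \o c) (fun u => dot (v (c u)) (grad g (c u))) t1 s 0 t1s
      (within_cont cg).
    rewrite mul0r => h; apply/eqP; rewrite -subr_eq0 -normr_le0; apply: h => u /andP[h1 h2].
      apply: is_derive_along => //; apply: hc.2; apply: in0; rewrite h1.
      exact: lt_le_trans sT.
    by rewrite orth ?normr0 // farc // (ltW h1) (le_trans (ltW h2)).
  have := @gronwall _ (fun s => dot (c s) (c s)) (fun s => 2 * dot (v (c s)) (c s))
    t1 T (2 * M) 0.
  rewrite mulr_ge0 // mul0r addr0 => h.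
  apply: (@le_trans _ _ (expR (2 * M * (T - t1)) * dot (c t1) (c t1))).
    apply: h => //; first exact: ltW.
    - exact: within_cont (continuous_dot hc.1).
    - by move=> s sT; apply: is_derive_dot; apply: hc.2; exact: in0.
    - move=> s /andP[h1 h2]; rewrite addr0 -mulrA ler_wpM2l //.
      apply: (le_trans (ler_norm _)); apply: hM; first by apply: gc; rewrite !ltW.
      by apply: farc; rewrite !ltW.
  apply: ler_wpDl => //; apply: ler_pM; rewrite ?expR_ge0 ?dot_ge0 //.
    by rewrite ler_expR ler_piMr ?mulr_ge0 //; lra.
  by rewrite -t1E; apply: hK1; rewrite t10 /=; lra.
have cdv : Ck_on 0 setT (fun z => 2 * dot (v z) z).
  have cid : Ck_on 0 setT (fun z : 'rV[R]_n => z) by move=> z _; exact: cvg_id.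
  apply: (Ck_mul openT (@Ck_cst _ _ R 0 setT (2 : R))).
  by apply: Ck_dot => //; exact: openT.
(* By [box_of_dot] this box contains all z with |z|^2 <= |rho0| + 1; there M bounds the derivative
   of |c|^2 along lines. *)
have [M M0 hM] := bounded_on_compact (box_compact (row_frame n) (`|rho0| + 2))
  (fun z => cdv z I).
(* In the time left after t1, |c|^2 can gain at most 1 at speed M, so it stays below |rho0| + 1 once
   it has been below rho0. *)
pose t1 := Num.max 0 (tau - (2 * (M + 1))^-1).
have M1 : 0 < 2 * (M + 1) by lra.
have t1tau : t1 < tau by rewrite /t1 gt_max tau0 /= ltrBlDr ltrDl invr_gt0.
have t10 : 0 <= t1 by rewrite /t1 le_max lexx.
have [T0 [c0 [/andP[t1T0 T0tau] hc0 c00 small]]] : exists T c,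
    [/\ t1 <= T < tau, flow_line v T c, c 0 = x & dot (c T) (c T) < rho0].
  apply: contrapT => nex; apply: near_; exists t1; first by rewrite t10.
  move=> T c hT hc c0; rewrite leNgt; apply/negP => lt; apply: nex.
  by exists T, c.
have T00 : 0 <= T0 by exact: le_trans t1T0.
have [K1 K10 hK1] := curve_dot_bounded hc0.1.
exists (K1 + (`|rho0| + 1)) => T c /andP[Tge0 Ttau] hc c0x.
have [TT0|T0T] := leP T T0.
  rewrite (uniq T c T0 c0) //; apply: ler_wpDr; first by rewrite addr_ge0.
  by apply: hK1; rewrite Tge0 /=; lra.
apply: ler_wpDl => //; apply: ltW.
have T0E : c0 T0 = c T0 by apply: (uniq T0 c0 T c) => //; exact: ltW.
have Mt : M * (T - T0) <= 1.
  have : T - T0 <= (2 * (M + 1))^-1.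
    have : tau - (2 * (M + 1))^-1 <= t1 by rewrite /t1 le_max lexx orbT.
    by move: t1T0 Ttau; lra.
  move=> h; apply: (@le_trans _ _ (M * (2 * (M + 1))^-1)); first by rewrite ler_wpM2l.
  by rewrite ler_pdivrMr //; lra.
apply: (@barrier (fun s => dot (c s) (c s)) (fun s => 2 * dot (v (c s)) (c s)) T0 T M) => //.
- exact: ltW.
- exact: continuous_dot hc.1.
- move=> s /andP[h1 h2]; apply: is_derive_dot; apply: hc.2.
  by rewrite h2 (le_lt_trans T00).
- move=> s _ hs; apply: (le_trans (ler_norm _)); apply: hM.
  have -> : `|rho0| + 2 = (`|rho0| + 1) + 1 by lra.
  by apply: box_of_dot; exact: ltW.
- have := ler_norm rho0; move: small; rewrite T0E; lra.
Qed.

End Completeness.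

(** * From the complete field to the trivialization *)

Section Trivialization.
Context {R : realType} {n : nat}.
Implicit Types (f g : 'rV[R]_n -> R) (x : 'rV[R]_n).

Lemma closed_le0 (h : 'rV[R]_n -> R) : Ck_on 0 setT h -> closed [set x | h x <= 0].
Proof.
move=> ch; have -> : [set x | h x <= 0] = h @^-1` [set s | s <= 0] by [].
by apply: closed_comp; [move=> x _; exact: ch|exact: closed_le].
Qed.

Lemma noncritical_near f (lam r : R) : smooth f -> 0 < r ->
  ~ critical_values f lam -> exists2 e : R, 0 < e &
  forall x, `|f x - lam| < e -> enorm x <= r -> grad f x != 0.
Proof.
move=> sf r0 ncrit.
pose K := [set x : 'rV[R]_n | dot x x - r ^+ 2 <= 0] `&` [set x | dot (grad f x) (grad f x) <= 0].
have cid : Ck_on 0 setT (fun x => x) by move=> x _; exact: cvg_id.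
have K1 : closed [set x : 'rV[R]_n | dot x x - r ^+ 2 <= 0].
  apply: (@closed_le0 (fun x : 'rV[R]_n => dot x x - r ^+ 2)).
  by apply: (Ck_add openT (Ck_dot openT cid cid)); exact: Ck_cst.
have K2 : closed [set x | dot (grad f x) (grad f x) <= 0].
  apply: (@closed_le0 (fun x => dot (grad f x) (grad f x))).
  by apply: (Ck_dot openT); exact: Ck_grad.
have cK : compact K.
  apply: subclosed_compact (box_compact (row_frame n) (r ^+ 2 + 1)) _.
    exact: closedI.
  by move=> x [/= h _]; apply: box_of_dot; rewrite -subr_le0.
have cfK : closed (f @` K).
  apply: compact_closed; first exact: Rhausdorff.
  apply: continuous_compact => //; apply: continuous_subspaceT => x.
  exact: (Ck_continuous (sf 0) (I : setT x)).
have : nbhs lam (~` (f @` K)).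
  apply: open_nbhs_nbhs; split; first exact: closed_openC.
  move=> [x [_ /= gx] fx]; apply: ncrit; exists x => //.
  by apply/eqP; rewrite -[_ == 0]negbK -dot_gt0 -leNgt.
move=> /nbhs_ballP[e /= e0 he]; exists e => // x fx xr.
apply/eqP => gx0; apply: (he (f x)).
  by rewrite /ball /= distrC.
exists x => //; split; last by rewrite /= gx0 dot0l.
by rewrite /= subr_le0 -enorm_le // ltW.
Qed.

(** Time s along w is time one along s w. With s as a constant coordinate, smoothness of E in (x, s)
    is smooth dependence on the initial point alone. *)
Definition scaled_field (w : 'rV[R]_n -> 'rV[R]_n) (p : 'rV[R]_n * R) : 'rV[R]_n * R :=
  (p.2 *: w p.1, 0).

Lemma smooth_scaled_field w : smooth w -> smooth (scaled_field w).
Proof.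
move=> sw k; apply: Ck_pair; [exact: openT| |exact: Ck_cst].
have h : Ck_on k setT (w \o (fst : 'rV[R]_n * R -> 'rV[R]_n)).
  apply: (Ck_comp (row_frame n) (row_frame n) openT openT _ _ (sw k)) => //.
  exact: Ck_fst.
exact: (Ck_scale openT (@Ck_snd R _ _ k setT) h).
Qed.

Lemma smooth_time_one w (c : 'rV[R]_n * R -> R -> 'rV[R]_n) : smooth w ->
  (forall p, flow_line (fun x => p.2 *: w x) 1 (c p)) -> (forall p, c p 0 = p.1) ->
  smooth (fun p => c p 1).
Proof.
move=> sw hc c0 k; have sF := smooth_scaled_field sw.
pose B := prod_frame (row_frame (R := R) n) real_frame.
have hl p : flow_line (scaled_field w) 1 (fun t => (c p t, p.2)).
  have [cc dc] := hc p; split=> [t|t t01]; first exact: (cvg_pair (cc t) (cvg_cst p.2)).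
  exact: (is_derive_pair_curve (dc t t01) (is_derive_cst p.2 t 1)).
apply: Ck_local => p _.
have [N [E [rho [[oN Np] cE hE]]]] := flow_Ck k B sF (hl p).
exists N; first by move: Np; rewrite c0; case: (p).
have := Ck_lin_comp oN (@lfst_cont R _ R) cE.
apply: Ck_eq => // q Nq /=; have [d [hd d0 <- _]] := hE q Nq.
have h12 : 1 <= 2 :> R by lra.
(* The lines of [flow_Ck] and the chosen curves c are unrelated a priori; uniqueness identifies
   them. *)
rewrite (flow_line_unique B (smooth_C1 sF) h12 hd (hl q)) //.
- by rewrite d0 c0; case: (q).
- by rewrite ler01 lexx.
Qed.

Lemma flow_reverse (w : 'rV[R]_n -> 'rV[R]_n) c : flow_line w 1 c ->
  flow_line (fun x => - w x) 1 (fun t => c (1 - t)).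
Proof.
move=> [cc hc].
have hr (t : R) : is_derive t 1 (fun s : R => 1 - s) (-1 : R).
  have := is_deriveB (is_derive_cst (1 : R) t 1) (is_derive_id t (1 : R)); rewrite sub0r; exact.
have cr : continuous (fun s : R => 1 - s).
  by move=> s; apply: cvgB; [exact: cvg_cst|exact: cvg_id].
split=> [t|t /andP[t0 t1]].
  by apply: (@continuous_comp _ _ _ (fun s : R => 1 - s) c); [exact: cr|exact: cc].
have t01 : 0 < 1 - t < 1 by apply/andP; split; lra.
have [dc cE] := hc _ t01; have /derivable1_diffP dc' := dc.
apply: is_derive_eq; first exact: (is_derive_curve (hr t) dc').
by rewrite deriveE // linearN -deriveE // cE.
Qed.

(** The rate of f along the line is s times a number in [0, 1], so f stays between f (c 0) and f (c
    0) + s, both in the band. Inside the band that number is 1, and f changes by exactly s. *)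
Lemma flow_level f (w : 'rV[R]_n -> 'rV[R]_n) (lam eta s : R) c : smooth f ->
  (forall x, 0 <= dot (w x) (grad f x) <= 1) ->
  (forall x, `|f x - lam| <= eta -> dot (w x) (grad f x) = 1) ->
  flow_line (fun x => s *: w x) 1 c ->
  `|f (c 0) - lam| <= eta -> `|f (c 0) + s - lam| <= eta -> f (c 1) = f (c 0) + s.
Proof.
move=> sf w01 w1 [cc hc] h0 h1.
have cf : continuous (f \o c).
  move=> u; apply: continuous_comp; first exact: cc.
  exact: (Ck_continuous (sf 0) (I : setT (c u))).
have step t : 0 <= t <= 1 -> exists2 u, 0 <= u <= t &
    f (c t) - f (c 0) = s * dot (w (c u)) (grad f (c u)) * t.
  move=> /andP[t0 t1].
  have [|u] := @MVT_segment R (f \o c) (fun u => s * dot (w (c u)) (grad f (c u))) 0 t t0 _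
    (within_cont cf).
    move=> u; rewrite in_itv /= => /andP[u0 ut]; rewrite -dotZl.
    by apply: is_derive_along => //; apply: hc; rewrite u0 (lt_le_trans ut).
  by rewrite in_itv /= subr0 => ut E; exists u.
have band t : 0 <= t <= 1 -> `|f (c t) - lam| <= eta.
  move=> t01; have [u _ E] := step t t01; have /andP[a0 a1] := w01 (c u).
  move: E h0 h1; set a := dot _ _ in a0 a1 *; rewrite !ler_norml => E /andP[h01 h02] /andP[h11 h12].
  have {}E : f (c t) = f (c 0) + s * (a * t) by rewrite mulrA -E addrC subrK.
  have b0 : 0 <= a * t by rewrite mulr_ge0 //; case/andP: t01.
  have b1 : a * t <= 1 by rewrite -[leRHS]mulr1 ler_pM //; case/andP: t01.
  rewrite E; apply/andP; split; nra.
have i01 : 0 <= (1 : R) <= 1 by rewrite ler01 lexx.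
have [u u01 E] := step 1 i01.
by move: E; rewrite (w1 _ (band u u01)) !mulr1 => <-; rewrite addrC subrK.
Qed.

Lemma smooth_on_smooth (V W : normedModType R) (A : set V) (F : V -> W) : smooth F -> smooth_on A F.
Proof. by move=> sF x _; exists setT, F; split=> //; split=> //; exact: openT. Qed.

Lemma malgrange_trivial f g (S : set R) (lam : R) : smooth f -> smooth g ->
  malgrange_at g S f lam -> ~ critical_values f lam ->
  exists2 U, open_nbhs lam U & trivial_over f lam U.
Proof.
move=> sf sg [U [oU Ulam] [r r0 [tube_grad tube_S tube_delta]]] ncrit.
have [e1 e10 he1] := noncritical_near sf r0 ncrit.
have [e2 /= e20 he2] : nbhs_ball lam U by apply/nbhs_ballP; exact: open_nbhs_nbhs.
pose eps := Num.min e1 e2.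
have eps0 : 0 < eps by rewrite lt_min e10 e20.
have lev x : `|f x - lam| < eps -> U (f x).
  by rewrite lt_min => /andP[_ h]; apply: he2; rewrite /ball /= distrC.
have inn x : `|f x - lam| < eps -> enorm x <= r -> grad f x != 0.
  by rewrite lt_min => /andP[h _]; exact: he1.
pose w := glued_field f g lam r eps.
have sw : smooth w by exact: (smooth_glued_field (S := S) (U := U)).
have w01 x : 0 <= dot (w x) (grad f x) <= 1 by exact: (glued_dot_itv (S := S) (U := U)).
have w1 x : `|f x - lam| <= eps / 4 -> dot (w x) (grad f x) = 1.
  exact: (glued_dot_eq1 (S := S) (U := U)).
have hc (p : 'rV[R]_n * R) : exists c, flow_line (fun x => p.2 *: w x) 1 c /\ c 0 = p.1.
  have [|||s|c hc c0] := @flow_complete R n g (fun x => p.2 *: w x) (2 * (r + 1) ^+ 2) p.1.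
  - move=> k; apply: Ck_scale; [exact: openT|exact: Ck_cst|exact: sw].
  - exact: sg.
  - by move=> z hz; rewrite dotZl glued_orthogonal ?mulr0.
  - have [M M0 hM] := glued_growth (f := f) (g := g) (S := S) (U := U) (lam := lam) r0 eps0 lev inn tube_S tube_delta s.
    exists (`|p.2| * M); first by rewrite mulr_ge0.
    by move=> z gz hz; rewrite dotZl normrM -mulrA ler_wpM2l // hM.
  by exists c.
have /choice[c {}hc] := hc.
pose E p := c p 1.
have sE : smooth E by apply: (smooth_time_one sw) => p; have [] := hc p.
(* The reversed line is a line of -s w from E (x, s) to x, and uniqueness identifies it with the
   chosen one. *)
have back x s : E (E (x, s), - s) = x.
  have [h1 h10] := hc (x, s); have [h2 h20] := hc (E (x, s), - s).
  have h3 : flow_line (fun x => (- s) *: w x) 1 (fun t => c (x, s) (1 - t)).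
    apply: (@flow_line_eq _ _ (fun x => - (s *: w x))); last exact: flow_reverse h1.
    by move=> t _; rewrite scaleNr.
  have cw : Ck_on 1 setT (fun x => (- s) *: w x).
    by apply: Ck_scale; [exact: openT|exact: Ck_cst|exact: sw].
  have h12 : 1 <= 2 :> R by lra.
  have := flow_line_unique (row_frame n) cw h12 h2 h3.
  rewrite h20 /= subr0 => /(_ erefl 1); rewrite ler01 lexx => /(_ isT) h.
  by rewrite /E h subrr h10.
have level x s : `|f x - lam| <= eps / 4 -> `|f x + s - lam| <= eps / 4 -> f (E (x, s)) = f x + s.
  have [h h0] := hc (x, s); have := flow_level sf w01 w1 h; rewrite h0 /=; exact.
have eta0 : 0 < eps / 4 by rewrite divr_gt0.
(* The band of levels on which <w, grad f> = 1. *)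
exists (ball lam (eps / 4)); first by split; [exact: ball_open|exact: ballxx].
have ballE t : ball lam (eps / 4) t -> `|t - lam| < eps / 4 by rewrite /ball /= distrC.
pose Phi x := (E (x, lam - f x), f x).
pose Psi (p : 'rV[R]_n * R) := E (p.1, p.2 - lam).
have c_cst (V : normedModType R) k (a : R) : Ck_on k setT (fun _ : V => a) by exact: Ck_cst.
have PsiPhi x : `|f x - lam| < eps / 4 -> Psi (Phi x) = x.
  by move=> fx; rewrite /Psi /Phi /= -(opprB lam) back.
have PhiPsi y t : f y = lam -> `|t - lam| < eps / 4 -> Phi (Psi (y, t)) = (y, t).
  move=> fy ht; rewrite /Psi /Phi /=.
  have -> : f (E (y, t - lam)) = t.
    have e : lam + (t - lam) = t by rewrite addrC subrK.
    by rewrite level fy ?e ?subrr ?normr0 // ltW.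
  by rewrite -(opprB t) back.
have fE y t : f y = lam -> `|t - lam| < eps / 4 -> f (Psi (y, t)) = t.
  by move=> fy ht; have := PhiPsi y t fy ht => -[].
exists Phi => //; split.
- split.
  + move=> x /= /ballE fx; split=> //=; last by rewrite /ball /= distrC.
    have e : f x + (lam - f x) = lam by rewrite addrC subrK.
    have h : `|f x + (lam - f x) - lam| <= eps / 4 by rewrite e subrr normr0 ltW.
    by rewrite (level _ _ (ltW fx) h).
  + move=> x y /set_mem /ballE fx /set_mem /ballE fy xy.
    by rewrite -(PsiPhi x fx) xy PsiPhi.
  + move=> [y t] /= [fy /ballE ht]; exists (Psi (y, t)); last exact: PhiPsi.
    by rewrite /= fE // /ball /= distrC.
- apply: smooth_on_smooth => k; apply: Ck_pair; [exact: openT| |exact: sf].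
  apply: (Ck_comp (prod_frame (row_frame n) real_frame) (row_frame n) openT openT _ _ (sE k)) => //.
  apply: Ck_pair; [exact: openT| |].
    by apply: (@Ck_lin R _ _ k setT idfun) => x; exact: cvg_id.
  apply: Ck_add; [exact: openT|exact: c_cst|].
  apply: Ck_eq (Ck_mul openT (c_cst _ k (-1)) (sf k)); first exact: openT.
  by move=> x _; rewrite mulN1r.
- exists Psi; last by move=> x /= /ballE; exact: PsiPhi.
  apply: smooth_on_smooth => k.
  apply: (Ck_comp (prod_frame (row_frame n) real_frame) (row_frame n) openT openT _ _ (sE k)) => //.
  apply: Ck_pair; [exact: openT|exact: Ck_fst|].
  by apply: Ck_add; [exact: openT|exact: Ck_snd|exact: c_cst].
Qed.

End Trivialization.

Theorem mainTheorem2 (R : realType) (n : nat) (f : 'rV[R]_n -> R)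
    (f_smooth : smooth f) :
  (forall (g : 'rV[R]_n -> R) (S : set R), smooth g -> open S ->
     bifurcation_values f `<=` malgrange_bad_values g S f `|` critical_values f)
  /\
  bifurcation_values f `<=`
    (\bigcap_(gS in smooth_open_pairs) malgrange_bad_values gS.1 gS.2 f)
    `|` critical_values f.
Proof.
split=> [g S g_smooth _ lam bif|lam bif].
  have [crit|ncrit] := pselect (critical_values f lam); first by right.
  by left=> mal; apply: bif; exact: malgrange_trivial f_smooth g_smooth mal ncrit.
have [crit|ncrit] := pselect (critical_values f lam); first by right.
left=> -[g S] [/= g_smooth _] mal; apply: bif.
exact: malgrange_trivial f_smooth g_smooth mal ncrit.
Qed.
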